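(* For framed (closed) virtual knots, the smoothing invariant $S$ is stronger than the polynomial invariant $p_t$: if $S(K)=S(K')$ then $p_t(K)=p_t(K')$, and there exist framed virtual knots $K_1,K_2$ with $p_t(K_1)=p_t(K_2)$ but $S(K_1)\neq S(K_2)$.
   Context: A virtual knot diagram is a generic immersion of an oriented circle in the plane, each double point being decorated either as a classical crossing (with over/under information, hence a sign $\mathrm{sgn}=\pm1$) or as a virtual crossing. Framed virtual knots are diagrams modulo the classical Reidemeister moves 2, 3, the purely virtual Reidemeister moves 1, 2, 3, the mixed move (sliding an arc carrying only virtual crossings past a classical crossing), and the framed Reidemeister move 1, which inserts or removes on an arc two consecutive kinks whose classical crossings have opposite signs. Framed virtual links are defined in the same way with several circles. The flat equivalence class (homotopy class) $[\cdot]$ of a framed virtual knot or link is its class modulo these moves together with crossing changes at classical crossings. For a diagram $K$ and a classical crossing $d$, $K^d_{sm}$ is the unordered two-component virtual link obtained by smoothing $d$ according to orientation. The smoothing invariant is $S(K)=\sum_d\mathrm{sgn}(d)[K^d_{sm}]$ (sum over all classical crossings), in the free abelian group generated by flat equivalence classes of framed virtual links with two unordered components. Choose an ordering $\{1,2\}$ of the two components of $K^d_{sm}$. For a classical crossing $x$ between the two components ($x\in1\cap2$) let $\mathrm{sgn}(x)=+1$ if the tangent vectors at $x$ (of component 1, of component 2), in this order, form a positively oriented basis of the plane, and $-1$ otherwise. Put $i(d)=\sum_{x\in1\cap2}\mathrm{sgn}(x)$; its absolute value does not depend on the ordering. The polynomial invariant is $p_t(K)=\sum_d\mathrm{sgn}(d)\,t^{|i(d)|}\in\mathbb{Z}[t]$.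 Both $S$ and $p_t$ are invariants of framed virtual knots. *)

(* Defs.v *)
From HB Require Import structures.
From Stdlib Require Import Relation_Operators.
From mathcomp Require Import all_boot all_order all_algebra.
From mathcomp Require Import generic_quotient boolp.
From mathcomp Require Import freeg.

Set Implicit Arguments.
Unset Strict Implicit.
Unset Printing Implicit Defensive.

Import GRing.Theory.
Local Open Scope ring_scope.
Local Open Scope quotient_scope.

(** * Plane diagrams

    A generic immersion of oriented circles in the plane is presented by its
    generic horizontal slices.  After a small isotopy the height function is
    Morse on the curve, and its minima, its maxima and the double points of the
    curve lie at distinct heights; the diagram is then the list, from bottom to
    top, of these events.  Between two consecutive events the diagram consists
    of finitely many vertical strands, numbered from left to right starting
    from 0.  The event [(k, e)] happens immediately to the right of the first
    [k] strands. *)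

(** The two strands of a double point are "/" and "\", according to the way they
    are read from bottom to top.  [Classical true] is a classical crossing whose
    over-strand is "/", [Classical false] one whose over-strand is "\". *)
Inductive crossing := Classical of bool | Virtual.

(** [Cup o] is a local minimum, whose left branch is oriented upward iff [o]
    (and whose right branch then is oriented downward iff [o]); [Cap] is a local
    maximum. *)
Inductive event := Cup of bool | Cap | Cross of crossing.

Definition slice : Type := nat * event.

Definition crossing_code (c : crossing) : option bool :=
  if c is Classical b then Some b else None.
Definition crossing_decode (o : option bool) : crossing :=
  if o is Some b then Classical b else Virtual.
Lemma crossing_codeK : cancel crossing_code crossing_decode.
Proof. by case. Qed.
HB.instance Definition _ := Choice.copy crossing (can_type crossing_codeK).

Definition event_code (e : event) : bool + option crossing :=
  match e with Cup o => inl o | Cap => inr None | Cross c => inr (Some c) end.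
Definition event_decode (x : bool + option crossing) : event :=
  match x with inl o => Cup o | inr None => Cap | inr (Some c) => Cross c end.
Lemma event_codeK : cancel event_code event_decode.
Proof. by case. Qed.
HB.instance Definition _ := Choice.copy event (can_type event_codeK).

Definition insert2 (T : Type) (k : nat) (x y : T) (s : seq T) : seq T :=
  take k s ++ [:: x; y] ++ drop k s.
Definition delete2 (T : Type) (k : nat) (s : seq T) : seq T :=
  take k s ++ drop k.+2 s.
Definition swap2 (T : Type) (x0 : T) (k : nat) (s : seq T) : seq T :=
  insert2 k (nth x0 s k.+1) (nth x0 s k) (delete2 k s).

(** A level is described by the orientations of its strands ([true] = upward).
    [step] fails when an event does not fit at its level: too few strands, or
    two branches of a maximum with incompatible orientations. *)
Definition step (s : seq bool) (x : slice) : option (seq bool) :=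
  let: (k, e) := x in
  match e with
  | Cup o => if (k <= size s)%N then Some (insert2 k o (~~ o) s) else None
  | Cap => if (k.+1 < size s)%N && (nth true s k != nth true s k.+1)
           then Some (delete2 k s) else None
  | Cross _ => if (k.+1 < size s)%N then Some (swap2 true k s) else None
  end.

Definition run (s : seq bool) (w : seq slice) : option (seq bool) :=
  foldl (fun r x => obind (step^~ x) r) (Some s) w.

Definition closed_diagram (w : seq slice) : bool := run [::] w == Some [::].

(** Diagrams of virtual links, with any number of components. *)
Definition link_diagram : Type := {w : seq slice | closed_diagram w}.

(** ** Strands and components *)

Definition slice_at (w : seq slice) (j : nat) : slice := nth (0%N, Cap) w j.

(** Orientations of the strands just below the event of index [j]. *)
Definition orientations (w : seq slice) (j : nat) : seq bool :=
  odflt [::] (run [::] (take j w)).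

(** Every strand is labelled by the index of the minimum from which it emanates
    when followed monotonically downward. *)
Fixpoint labels (w : seq slice) (j : nat) : seq nat :=
  if j is i.+1 then
    let s := labels w i in
    let: (k, e) := slice_at w i in
    match e with
    | Cup _ => insert2 k i i s
    | Cap => delete2 k s
    | Cross _ => swap2 0%N k s
    end
  else [::].

(** The two strands entering the event of index [j] from below.  At a crossing
    the left one continues as "/" and the right one as "\". *)
Definition left_label (w : seq slice) (j : nat) : nat :=
  nth 0%N (labels w j) (slice_at w j).1.
Definition right_label (w : seq slice) (j : nat) : nat :=
  nth 0%N (labels w j) (slice_at w j).1.+1.
Definition left_up (w : seq slice) (j : nat) : bool :=
  nth true (orientations w j) (slice_at w j).1.
Definition right_up (w : seq slice) (j : nat) : bool :=
  nth true (orientations w j) (slice_at w j).1.+1.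

Definition is_min (w : seq slice) (j : nat) : bool :=
  if (slice_at w j).2 is Cup _ then true else false.

Definition is_classical (w : seq slice) (j : nat) : bool :=
  if (slice_at w j).2 is Cross (Classical _) then true else false.

(** Minima [a] and [b] are adjacent when some maximum joins strands emanating
    from them; the components of the link are the connected components of this
    graph on the set of minima. *)
Definition adjacent (w : seq slice) : rel 'I_(size w) := fun a b =>
  [exists j : 'I_(size w), ((slice_at w j).2 == Cap) &&
     (((left_label w j == a) && (right_label w j == b)) ||
      ((left_label w j == b) && (right_label w j == a)))].

Definition number_of_components (w : seq slice) : nat :=
  n_comp (@adjacent w) [pred a : 'I_(size w) | is_min w a].

Definition same_component (w : seq slice) (a b : nat) : bool :=
  [exists x : 'I_(size w), [exists y : 'I_(size w),
     [&& x == a :> nat, y == b :> nat & connect (@adjacent w) x y]]].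

Definition knot_diagram : Type :=
  {D : link_diagram | number_of_components (val D) == 1%N}.

Definition word (D : knot_diagram) : seq slice := val (val D).

(** * Moves *)

(** Numbers of strands just below and just above an event. *)
Definition strands_in (e : event) : nat := if e is Cup _ then 0%N else 2%N.
Definition strands_out (e : event) : nat := if e is Cap then 0%N else 2%N.

(** Exchange of the roles of "/" and "\": for a classical crossing this is the
    crossing change. *)
Definition flip (c : crossing) : crossing :=
  if c is Classical b then Classical (~~ b) else Virtual.

(** Planar isotopy.  The singularities of the height function in a generic
    isotopy of a generic immersion are: two events at the same height
    ([far_commute]), a cubic inflection creating or cancelling a minimum and a
    maximum ([zigzag_left], [zigzag_right]), and a double point one of whose
    branches is horizontal ([slide_min], [slide_max]). *)
Inductive planar_isotopy : seq slice -> seq slice -> Prop :=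
| far_commute k l e f : (k <= l)%N ->
    planar_isotopy [:: (k, e); (l + strands_out e, f)%N]
                   [:: (l + strands_in e, f)%N; (k, e)]
| zigzag_left k o : planar_isotopy [:: (k, Cup o); (k.+1, Cap)] [::]
| zigzag_right k o : planar_isotopy [:: (k.+1, Cup o); (k, Cap)] [::]
| slide_min k o c :
    planar_isotopy [:: (k, Cup o); (k.+1, Cross c)]
                   [:: (k.+1, Cup o); (k, Cross (flip c))]
| slide_max k c :
    planar_isotopy [:: (k, Cross c); (k.+1, Cap)]
                   [:: (k.+1, Cross (flip c)); (k, Cap)].

(** A kink on the strand [k], with its loop on the left or on the right of the
    strand.  With either side, its classical crossing is positive iff its
    over-strand is "/", whatever the orientation of the strand. *)
Inductive side := OnLeft | OnRight.
Definition kink (d : side) (k : nat) (o : bool) (c : crossing) : seq slice :=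
  match d with
  | OnLeft => [:: (k, Cup o); (k.+1, Cross c); (k, Cap)]
  | OnRight => [:: (k.+1, Cup o); (k, Cross c); (k.+1, Cap)]
  end.

(** The three strands numbered 1, 2, 3 from left to right at the bottom cross
    pairwise; [a], [b] and [c] are the crossings of 1 with 2, of 1 with 3 and of
    2 with 3, in which the strand of smaller number is always "/". *)
Definition triangle_low (k : nat) (a b c : crossing) : seq slice :=
  [:: (k, Cross a); (k.+1, Cross b); (k, Cross c)].
Definition triangle_high (k : nat) (a b c : crossing) : seq slice :=
  [:: (k.+1, Cross c); (k, Cross b); (k.+1, Cross a)].

(** The condition in [classical_R3] says that the three strands lie at three
    different heights over the plane: it excludes 1 over 2 over 3 over 1 and
    1 under 2 under 3 under 1.  In [mixed_i] the arc [i] carries only virtual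
    crossings and slides past a classical crossing. *)
Inductive framed_move : seq slice -> seq slice -> Prop :=
| isotopy l r : planar_isotopy l r -> framed_move l r
| framed_R1 d d' k o o' b :
    framed_move (kink d k o (Classical b) ++ kink d' k o' (Classical (~~ b)))
                [::]
| classical_R2 k b :
    framed_move [:: (k, Cross (Classical b)); (k, Cross (Classical (~~ b)))]
                [::]
| classical_R3 k a b c : b = a \/ b = c ->
    framed_move (triangle_low k (Classical a) (Classical b) (Classical c))
                (triangle_high k (Classical a) (Classical b) (Classical c))
| virtual_R1 d k o : framed_move (kink d k o Virtual) [::]
| virtual_R2 k : framed_move [:: (k, Cross Virtual); (k, Cross Virtual)] [::]
| virtual_R3 k :
    framed_move (triangle_low k Virtual Virtual Virtual)
                (triangle_high k Virtual Virtual Virtual)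
| mixed_1 k c :
    framed_move (triangle_low k Virtual Virtual (Classical c))
                (triangle_high k Virtual Virtual (Classical c))
| mixed_2 k b :
    framed_move (triangle_low k Virtual (Classical b) Virtual)
                (triangle_high k Virtual (Classical b) Virtual)
| mixed_3 k a :
    framed_move (triangle_low k (Classical a) Virtual Virtual)
                (triangle_high k (Classical a) Virtual Virtual).

Inductive flat_move : seq slice -> seq slice -> Prop :=
| flat_framed l r : framed_move l r -> flat_move l r
| crossing_change k b :
    flat_move [:: (k, Cross (Classical b))] [:: (k, Cross (Classical (~~ b)))].

(** Application of a move somewhere in a diagram. *)
Definition local_move (M : seq slice -> seq slice -> Prop)
    (D D' : link_diagram) : Prop :=
  exists below above l r, [/\ M l r,
    val D = below ++ l ++ above & val D' = below ++ r ++ above].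

Definition move_equiv (M : seq slice -> seq slice -> Prop) :
    link_diagram -> link_diagram -> Prop :=
  clos_refl_sym_trans link_diagram (local_move M).

Lemma move_equiv_refl M : reflexive (fun D D' => `[< move_equiv M D D' >]).
Proof. by move=> D; apply/asboolP/rst_refl. Qed.

Lemma move_equiv_sym M : symmetric (fun D D' => `[< move_equiv M D D' >]).
Proof.
by move=> D D'; apply/idP/idP => /asboolP h; apply/asboolP/rst_sym.
Qed.

Lemma move_equiv_trans M : transitive (fun D D' => `[< move_equiv M D D' >]).
Proof.
move=> D2 D1 D3 /asboolP h /asboolP h'.
by apply/asboolP; apply: rst_trans h h'.
Qed.

(** ** Framed virtual knots and flat equivalence classes *)

Definition framed_rel (D D' : knot_diagram) : bool :=
  `[< move_equiv framed_move (val D) (val D') >].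

Canonical framed_equiv_rel := EquivRel framed_rel
  (fun D => move_equiv_refl framed_move (val D))
  (fun D D' => move_equiv_sym framed_move (val D) (val D'))
  (fun D2 D1 D3 => @move_equiv_trans framed_move (val D2) (val D1) (val D3)).

Definition framed_virtual_knot : Type := {eq_quot framed_rel}.

Definition represents (D : knot_diagram) (K : framed_virtual_knot) : Prop :=
  \pi_{eq_quot framed_rel} D = K.

Definition flat_rel (D D' : link_diagram) : bool :=
  `[< move_equiv flat_move D D' >].

Canonical flat_equiv_rel := EquivRel flat_rel
  (move_equiv_refl flat_move) (move_equiv_sym flat_move)
  (@move_equiv_trans flat_move).

Definition flat_class : Type := {eq_quot flat_rel}.
HB.instance Definition _ := Choice.on flat_class.

Definition flat_class_of (D : link_diagram) : flat_class :=
  \pi_{eq_quot flat_rel} D.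

(** * The invariants *)

(** Sign of the basis (tangent of "/", tangent of "\") at a crossing. *)
Definition basis_sign (w : seq slice) (j : nat) : int :=
  if left_up w j == right_up w j then 1 else -1.

(** Sign of a classical crossing: sign of the basis (tangent of the over-strand,
    tangent of the under-strand).  Only used at classical crossings. *)
Definition crossing_sign (w : seq slice) (j : nat) : int :=
  match (slice_at w j).2 with
  | Cross (Classical true) => basis_sign w j
  | Cross (Classical false) => - basis_sign w j
  | _ => 0
  end.

(** Smoothing of the classical crossing [j] according to orientation: two
    vertical strands when both strands are oriented upward or both downward, a
    maximum below a minimum otherwise.  Only used at classical crossings. *)
Definition smooth_word (w : seq slice) (j : nat) : seq slice :=
  if is_classical w j then
    let k := (slice_at w j).1 in
    take j w ++
    (if left_up w j == right_up w j then [::]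
     else [:: (k, Cap); (k, Cup (~~ left_up w j))]) ++
    drop j.+1 w
  else w.

Lemma run_cat s w w' : run s (w ++ w') = obind (run^~ w') (run s w).
Proof.
rewrite /run foldl_cat; case: (foldl _ _ w) => //=.
by elim: w' => //= x w' ->.
Qed.

Lemma run_smoothing s s' k c : step s (k, Cross c) = Some s' ->
  run s (if nth true s k == nth true s k.+1 then [::]
         else [:: (k, Cap); (k, Cup (~~ nth true s k))]) = Some s'.
Proof.
rewrite /=; case: ltnP => // ks [<-].
have take_s : size (take k s) = k by rewrite size_takel // ltnW // ltnW.
case: eqP => [eq_up | /eqP neq_up].
  rewrite /= /swap2 /insert2 /delete2 eq_up take_size_cat // drop_size_cat //.
  congr Some; rewrite -{1}(cat_take_drop k s) (drop_nth true) ?(ltnW ks) //.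
  by rewrite (drop_nth true ks) eq_up.
rewrite /run /= ks neq_up /= size_cat take_s leq_addr.
by congr (Some (insert2 _ _ _ _)); move: neq_up; do 2!case: nth.
Qed.

Lemma smooth_closed w j : closed_diagram w -> closed_diagram (smooth_word w j).
Proof.
rewrite /closed_diagram /smooth_word; case: ifP => // cl.
have [jw | wj] := ltnP j (size w); last first.
  by move: cl; rewrite /is_classical /slice_at nth_default.
rewrite -{1}(cat_take_drop j w) (drop_nth (0%N, Cap) jw) !run_cat.
rewrite /left_up /right_up /orientations; case: (run [::] _) => //= s.
rewrite -cat1s run_cat run_cat -/(slice_at w j).
move: cl; rewrite /is_classical; case: (slice_at w j) => k [//||[b|]//] //= _.
have -> : run s [:: (k, Cross (Classical b))] = step s (k, Cross (Classical b)).
  by [].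
by case E: step => [s'|] //=; rewrite (run_smoothing E).
Qed.

Definition smooth (D : link_diagram) (j : nat) : link_diagram :=
  exist _ (smooth_word (val D) j) (smooth_closed j (valP D)).

(** For a diagram with two components, the sum over the classical crossings
    between them of the sign of the basis (tangent of component 1, tangent of
    component 2).  The ordering is fixed by taking as component 1 the one that
    contains the lowest event, which is a minimum and has index 0. *)
Definition intersection_index (w : seq slice) : int :=
  let in1 := same_component w 0 in
  \sum_(j < size w | is_classical w j)
    (if in1 (left_label w j) && ~~ in1 (right_label w j) then basis_sign w j
     else if ~~ in1 (left_label w j) && in1 (right_label w j)
     then - basis_sign w j
     else 0).

Definition polynomial_invariant (K : knot_diagram) : {poly int} :=
  \sum_(d < size (word K) | is_classical (word K) d)
    crossing_sign (word K) d *: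
      'X^(absz (intersection_index (smooth_word (word K) d))).

(** The values lie in the subgroup spanned by the classes of links with two
    components: smoothing a knot according to orientation gives two components,
    and the moves preserve the number of components. *)
Definition smoothing_invariant (K : knot_diagram) : {freeg flat_class / int} :=
  \sum_(d < size (word K) | is_classical (word K) d)
    << crossing_sign (word K) d *g flat_class_of (smooth (val K) d) >>.

(* Main.v *)
(** Let [f] be a number attached to flat links that does not change when a kink
    is removed.  Then the sum of [sgn(d) t^f(K_sm^d)] over the crossings [d] of
    [K] is an invariant of framed virtual knots, and it is determined by [S(K)].
    Two such numbers come from colourings of the strands.

    Colouring the components by booleans and counting the signed crossings from
    one colour to the other gives the maximum of [|i|]; it equals [|i(d)|] on
    [K_sm^d], and the sum is [p_t(K)].

    The second number, on a link with two components and even [i], is the parity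
    of the number of self-crossings whose loop meets the other component an odd
    number of times.  The closure of a virtual braid with three strands and a
    circle with two positive kinks have [p_t = 2], but the second sums are [2t]
    and [2].

    Both numbers are computed by state sums, so that, apart from the exchange of
    distant events, every move is checked on all colourings of its at most three
    strands, before and after smoothing one of its crossings. *)

From mathcomp Require Import all_boot all_algebra.
From mathcomp Require Import generic_quotient boolp zify.
From mathcomp Require Import freeg.
Require Import Defs.

Set Implicit Arguments.
Unset Strict Implicit.
Unset Printing Implicit Defensive.

Import GRing.Theory.
Local Open Scope ring_scope.
Local Open Scope quotient_scope.

(** * Locality: runs and smoothings of a word inside a window of strands *)

Lemma step_strands o k e : step o (k, e) <> None -> (k + strands_in e <= size o)%N.
Proof. by case: e => [b||c] /=; rewrite ?addn0 ?addn2; case: ifP => // /andP[]. Qed.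

Definition orient_act (e : event) (x : seq bool) : option (seq bool) :=
  match e, x with
  | Cup o, [::] => Some [:: o; ~~ o]
  | Cap, [:: a; b] => if a != b then Some [::] else None
  | Cross _, [:: a; b] => Some [:: b; a]
  | _, _ => None
  end.

(** An event acts only on the strands that it touches, here [x]. Splitting a level as [A ++ x ++ B]
    replaces the [take] and [drop] arithmetic of [step] in what follows. *)
Lemma stepE A x B k e : size A = k -> size x = strands_in e ->
  step (A ++ x ++ B) (k, e) = omap (fun y => A ++ y ++ B) (orient_act e x).
Proof.
move=> <-; case: e => [o||c] /=.
- by move/size0nil=> ->; rewrite size_cat leq_addr /insert2 take_size_cat ?drop_size_cat.
- case: x => [|a [|b []]] // _; rewrite !size_cat /= -{1}[size A]addn0 -addnS ltn_add2l /=.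
  rewrite !nth_cat ltnn subnn ltnNge leqnSn subSnn /=; case: eqP => //= _.
  by rewrite /delete2 take_size_cat // -add2n -drop_drop drop_size_cat //= ?drop0.
- case: x => [|a [|b []]] // _; rewrite !size_cat /= -{1}[size A]addn0 -addnS ltn_add2l /=.
  rewrite /swap2 !nth_cat ltnn subnn ltnNge leqnSn subSnn /= /insert2 /delete2.
  rewrite (@take_size_cat _ _ A) // -[(size A).+2]add2n -drop_drop drop_size_cat //= ?drop0.
  by rewrite take_size_cat // drop_size_cat.
Qed.

Local Arguments step : simpl never.

Lemma run_cons o x w : run o (x :: w) = obind (run^~ w) (step o x).
Proof. by rewrite -cat1s run_cat. Qed.

Definition shift (n : nat) (w : seq slice) : seq slice :=
  [seq ((n + x.1)%N, x.2) | x <- w].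

Lemma shift_cat n u v : shift n (u ++ v) = shift n u ++ shift n v.
Proof. exact: map_cat. Qed.

(** Strand count alone, without orientations: it tells whether a word stays within a window of [m]
    strands. *)
Fixpoint height (m : nat) (w : seq slice) : option nat :=
  if w is (k, e) :: w' then
    if (k + strands_in e <= m)%N
    then height (m - strands_in e + strands_out e) w' else None
  else Some m.

Lemma orient_act_size e x y : orient_act e x = Some y -> size y = strands_out e.
Proof. by case: e x => [o||c] [|a [|b []]] //=; [case=> <-|case: ifP => // _ [<-]|case=> <-]. Qed.

Lemma split_window (T : Type) (s : seq T) k n : (k + n <= size s)%N ->
  exists A x B, [/\ s = A ++ x ++ B, size A = k & size x = n].
Proof.
move=> h; exists (take k s), (take n (drop k s)), (drop n (drop k s)).
rewrite !cat_take_drop size_takel ?size_takel ?size_drop //; lia.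
Qed.

Lemma size_step o k e o1 : step o (k, e) = Some o1 ->
  size o1 = (size o - strands_in e + strands_out e)%N.
Proof.
move=> h; have /step_strands : step o (k, e) <> None by rewrite h.
case/split_window=> A [x [B [E sA sx]]]; move: h; rewrite E stepE //.
case H: orient_act => [y|] //= [<-]; rewrite !size_cat (orient_act_size H) sx; lia.
Qed.

Lemma run_height o w o1 : run o w = Some o1 -> height (size o) w = Some (size o1).
Proof.
elim: w o => [|[k e] w IH] o; first by case=> <-.
rewrite run_cons; case h: step => [o2|] //= /IH <-.
have /step_strands -> : step o (k, e) <> None by rewrite h.
by rewrite (size_step h).
Qed.

Lemma step_frame A x B k e : (k + strands_in e <= size x)%N ->
  step (A ++ x ++ B) ((size A + k)%N, e) = omap (fun y => A ++ y ++ B) (step x (k, e)).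
Proof.
case/split_window=> P [y [Q [-> sP sy]]].
rewrite [in RHS]stepE // (_ : A ++ _ = (A ++ P) ++ y ++ (Q ++ B)); last by rewrite !catA.
by rewrite stepE ?size_cat ?sP //; case: orient_act => //= z; rewrite !catA.
Qed.

(** The hypothesis keeps the word inside [x]: an event that does not fit on [x] could still fit on
    the wider level by reaching into [B]. *)
Lemma run_frame A x B w : height (size x) w ->
  run (A ++ x ++ B) (shift (size A) w) = omap (fun y => A ++ y ++ B) (run x w).
Proof.
elim: w x => [|[k e] w IH] x //=; case: ifP => // h hw.
rewrite !run_cons step_frame //; case H: step => [y|] //=.
by rewrite IH // (size_step H).
Qed.

(** All smoothings with the sign of the smoothed crossing, for an open word above a level [o], so
    that a diagram can be cut into pieces around a move. *)
Fixpoint smoothings (o : seq bool) (w : seq slice) : seq (int * seq slice) :=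
  if w is x :: w' then
    (if x.2 is Cross (Classical b) then
       let: (l, r) := (nth true o x.1, nth true o x.1.+1) in
       [:: (if (l == r) == b then 1 else -1,
            (if l == r then [::] else [:: (x.1, Cap); (x.1, Cup (~~ l))]) ++ w')]
     else [::])
    ++ [seq (t.1, x :: t.2) | t <- smoothings (odflt [::] (step o x)) w']
  else [::].

Lemma smoothings_cat o o1 u v : run o u = Some o1 ->
  smoothings o (u ++ v) =
    [seq (t.1, t.2 ++ v) | t <- smoothings o u] ++
    [seq (t.1, u ++ t.2) | t <- smoothings o1 v].
Proof.
elim: u o => [|x u IH] o; first by case=> ->; rewrite /= -[LHS]map_id; apply: eq_map => -[].
rewrite run_cons; case h: step => [o2|] //= /IH {}IH.
rewrite h /= IH map_cat -!map_comp map_cat -catA.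
congr (_ ++ _); last by rewrite -map_comp.
by case: x.2 => // -[b|] //=; rewrite catA.
Qed.

Lemma smoothings_frame A x B w : run x w ->
  smoothings (A ++ x ++ B) (shift (size A) w) =
    [seq (t.1, shift (size A) t.2) | t <- smoothings x w].
Proof.
elim: w x => [|[k e] w IH] x //=; rewrite run_cons.
case h: step => [y|] //= /IH {}IH.
have hk : (k + strands_in e <= size x)%N by apply: step_strands; rewrite h.
rewrite /= step_frame // h /= IH map_cat -!map_comp; congr (_ ++ _).
case: e {h} hk => // -[b|] //=; rewrite addn2 => hk.
rewrite -addnS !nth_cat !addKn hk (ltnW hk) !ltnNge !leq_addr /=.
by rewrite shift_cat; case: (nth true x k == _).
Qed.

Lemma run_smoothings o w o1 t : run o w = Some o1 -> t \in smoothings o w ->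
  run o t.2 = Some o1.
Proof.
elim: w o t => [|[k e] w IH] o t //=; rewrite run_cons.
case h: step => [y|] //= hr; rewrite mem_cat => /orP[|/mapP[t' /(IH _ _ hr) ht' ->]]; last first.
  by rewrite run_cons h.
case: e h => // -[b|] // h; rewrite inE => /eqP ->.
by rewrite /= run_cat (run_smoothing h).
Qed.

(** This links the sums over crossing indices in the invariants to the recursive list, on which
    induction and computation work. *)
Lemma sum_smoothings (V : zmodType) (G : int -> seq slice -> V) w : closed_diagram w ->
  \sum_(d < size w | is_classical w d) G (crossing_sign w d) (smooth_word w d) =
  \sum_(t <- smoothings [::] w) G t.1 t.2.
Proof.
move=> /eqP cl.
(* The induction is on the part [v] of the word still to be read, above a prefix [u] that ends at
   the level [o]. *)
suff : forall u v o, run [::] u = Some o -> run o v -> w = u ++ v ->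
    \sum_(d < size v | is_classical w (size u + d))
       G (crossing_sign w (size u + d)) (smooth_word w (size u + d)) =
    \sum_(t <- smoothings o v) G t.1 (u ++ t.2).
  by move=> H; apply: (H [::] w [::]) => //; rewrite cl.
move=> u v o; elim: v u o => [|[k e] v IH] u o hu hv hw; first by rewrite big_ord0 big_nil.
rewrite big_mkcond big_ord_recl -big_mkcond /= big_cat big_map /=.
move: hv; rewrite run_cons; case h: step => [o1|] //= hv.
have : \sum_(t <- smoothings o1 v) G t.1 (rcons u (k, e) ++ t.2) =
            \sum_(t <- smoothings o1 v) G t.1 (u ++ (k, e) :: t.2).
  by apply: eq_bigr => t _; rewrite cat_rcons.
move=> <-; rewrite -IH ?cat_rcons //; last by rewrite -cats1 run_cat hu /= run_cons h.
rewrite /= size_rcons; congr (_ + _); last first.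
  by apply: eq_big => [i|i _]; rewrite /bump /= add1n addnS.
rewrite addn0; have sl : slice_at w (size u) = (k, e).
  by rewrite /slice_at hw nth_cat ltnn subnn.
rewrite /is_classical sl /=; case: e h sl {hv IH} hw => [a||[b|]] h sl hw; rewrite ?big_nil //.
rewrite big_seq1 /= /crossing_sign /smooth_word /is_classical sl /=.
rewrite /basis_sign /left_up /right_up /orientations sl /= hw take_size_cat // hu /=.
rewrite -cat_rcons drop_size_cat ?size_rcons //.
by congr G; case: b {h sl hw}; case: eqP; rewrite ?opprK.
Qed.

(** * The local moves as a finite list, up to horizontal translation *)

Definition bools := [:: true; false].
Definition sides := [:: OnLeft; OnRight].
Definition crossings := [:: Virtual; Classical true; Classical false].

Definition R3_allowed (a b c : crossing) : bool :=
  match a, b, c with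
  | Classical x, Classical y, Classical z => (y == x) || (y == z)
  | Virtual, Virtual, _ | Virtual, _, Virtual | _, Virtual, Virtual => true
  | _, _, _ => false
  end.

(** The moves other than [far_commute], at the left end of the diagram; the first
    entry is the number of strands involved. *)
Definition window_moves : seq (nat * seq slice * seq slice) :=
  [seq (1%N, [:: (0%N, Cup o); (1%N, Cap)], [::]) | o <- bools] ++
  [seq (1%N, [:: (1%N, Cup o); (0%N, Cap)], [::]) | o <- bools] ++
  [seq (1%N, [:: (0%N, Cup o); (1%N, Cross c)], [:: (1%N, Cup o); (0%N, Cross (flip c))])
  | o <- bools, c <- crossings] ++
  [seq (3%N, [:: (0%N, Cross c); (1%N, Cap)], [:: (1%N, Cross (flip c)); (0%N, Cap)])
  | c <- crossings] ++
  [seq (1%N, kink t.1.1 0 t.1.2 (Classical b) ++ kink t.2.1 0 t.2.2 (Classical (~~ b)), [::])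
  | t <- [seq (k, k') | k <- [seq (d, o) | d <- sides, o <- bools],
                        k' <- [seq (d, o) | d <- sides, o <- bools]], b <- bools] ++
  [seq (1%N, kink d 0 o Virtual, [::]) | d <- sides, o <- bools] ++
  [seq (2%N, [:: (0%N, Cross c); (0%N, Cross (flip c))], [::]) | c <- crossings] ++
  [seq (3%N, triangle_low 0 t.1.1 t.1.2 t.2, triangle_high 0 t.1.1 t.1.2 t.2)
  | t <- [seq t <- [seq (ab, c) | ab <- [seq (a, b) | a <- crossings, b <- crossings],
                                  c <- crossings] | R3_allowed t.1.1 t.1.2 t.2]].

(** Only the exchange of distant events involves unboundedly many strands. Every other move is a
    translate of one of finitely many, which computation can check. *)
Lemma framed_move_window l r : framed_move l r ->
  (exists k n e f, [/\ (k <= n)%N, l = [:: (k, e); (n + strands_out e, f)%N]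
                                & r = [:: (n + strands_in e, f)%N; (k, e)]]) \/
  (exists k m l0 r0, [/\ (m, l0, r0) \in window_moves, l = shift k l0 & r = shift k r0]).
Proof.
have shift0 k : k = (k + 0)%N by rewrite addn0.
have shift1 k : k.+1 = (k + 1)%N by rewrite addn1.
have window k m l0 r0 l1 r1 : (m, l0, r0) \in window_moves -> l1 = shift k l0 -> r1 = shift k r0 ->
    exists k m l0 r0, [/\ (m, l0, r0) \in window_moves, l1 = shift k l0 & r1 = shift k r0].
  by move=> h -> ->; exists k, m, l0, r0.
case=> [{}l {}r []|||||||||].
- by move=> k n e f kn; left; exists k, n, e, f.
- move=> k o; right; apply: (window k 1%N [:: (0%N, Cup o); (1%N, Cap)] [::]).
  + by case: o; vm_compute.
  + by rewrite /shift /= addn0 addn1.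
  + by [].
- move=> k o; right; apply: (window k 1%N [:: (1%N, Cup o); (0%N, Cap)] [::]).
  + by case: o; vm_compute.
  + by rewrite /shift /= addn0 addn1.
  + by [].
- move=> k o c; right; apply: (window k 1%N [:: (0%N, Cup o); (1%N, Cross c)]
    [:: (1%N, Cup o); (0%N, Cross (flip c))]).
  + by case: o; case: c => // -[]; vm_compute.
  + by rewrite /shift /= addn0 addn1.
  + by rewrite /shift /= addn0 addn1.
- move=> k c; right; apply: (window k 3%N [:: (0%N, Cross c); (1%N, Cap)]
    [:: (1%N, Cross (flip c)); (0%N, Cap)]).
  + by case: c => // -[]; vm_compute.
  + by rewrite /shift /= addn0 addn1.
  + by rewrite /shift /= addn0 addn1.
- move=> d d' k o o' b; right.
  apply: (window k 1%N (kink d 0 o (Classical b) ++ kink d' 0 o' (Classical (~~ b))) [::]) => //.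
  + by case: d; case: d'; case: o; case: o'; case: b; vm_compute.
  + by case: d; case: d'; rewrite /shift /= addn0 addn1.
- move=> k b; right.
  apply: (window k 2%N [:: (0%N, Cross (Classical b)); (0%N, Cross (Classical (~~ b)))] [::]) => //.
  + by case: b; vm_compute.
  + by rewrite /shift /= addn0.
- move=> k a b c abc; right.
  apply: (window k 3%N (triangle_low 0 (Classical a) (Classical b) (Classical c))
    (triangle_high 0 (Classical a) (Classical b) (Classical c))).
  + by case: abc => ->; case: a; case: c; vm_compute.
  + by rewrite /shift /= addn0 addn1.
  + by rewrite /shift /= addn0 addn1.
- move=> d k o; right; apply: (window k 1%N (kink d 0 o Virtual) [::]) => //.
  + by case: d; case: o; vm_compute.
  + by case: d; rewrite /shift /= addn0 addn1.
- move=> k; right.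
  apply: (window k 2%N [:: (0%N, Cross Virtual); (0%N, Cross Virtual)] [::]) => //.
  by rewrite /shift /= addn0.
- move=> k; right; apply: (window k 3%N (triangle_low 0 Virtual Virtual Virtual)
    (triangle_high 0 Virtual Virtual Virtual)); last 2 first.
  + by rewrite /shift /= addn0 addn1.
  + by rewrite /shift /= addn0 addn1.
  by vm_compute.
- move=> k c; right; apply: (window k 3%N (triangle_low 0 Virtual Virtual (Classical c))
    (triangle_high 0 Virtual Virtual (Classical c))).
  + by case: c; vm_compute.
  + by rewrite /shift /= addn0 addn1.
  + by rewrite /shift /= addn0 addn1.
- move=> k c; right; apply: (window k 3%N (triangle_low 0 Virtual (Classical c) Virtual)
    (triangle_high 0 Virtual (Classical c) Virtual)).
  + by case: c; vm_compute.
  + by rewrite /shift /= addn0 addn1.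
  + by rewrite /shift /= addn0 addn1.
- move=> k c; right; apply: (window k 3%N (triangle_low 0 (Classical c) Virtual Virtual)
    (triangle_high 0 (Classical c) Virtual Virtual)).
  + by case: c; vm_compute.
  + by rewrite /shift /= addn0 addn1.
  + by rewrite /shift /= addn0 addn1.
Qed.

(** * State sums over colourings of the strands, and their invariance *)

Section ColouredRuns.

Variables (C : eqType) (W : zmodType).
Variables (rule : bool -> bool -> C -> C -> C * C * W) (colours : seq C).

Let strand : Type := (bool * C)%type.

(** A minimum gives its two branches one arbitrary colour and a maximum requires equal colours. At a
    classical crossing [rule] receives the orientations and colours of the left and right strands,
    and returns the new colours from left to right and a weight. It does not receive the over/under
    information, so crossing changes have no effect. *)
Definition act (e : event) (x : seq strand) : seq (seq strand * W) :=
  match e, x with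
  | Cup o, [::] => [seq ([:: (o, c); (~~ o, c)], 0) | c <- colours]
  | Cap, [:: a; b] => if (a.1 != b.1) && (a.2 == b.2) then [:: ([::], 0)] else [::]
  | Cross Virtual, [:: a; b] => [:: ([:: b; a], 0)]
  | Cross (Classical _), [:: a; b] =>
    let: (c, d, z) := rule a.1 b.1 a.2 b.2 in [:: ([:: (b.1, c); (a.1, d)], z)]
  | _, _ => [::]
  end.

Definition cstep (s : seq strand) (x : slice) : seq (seq strand * W) :=
  let: (k, e) := x in
  if (k + strands_in e <= size s)%N then
    [seq (take k s ++ t.1 ++ drop (k + strands_in e) s, t.2)
    | t <- act e (take (strands_in e) (drop k s))]
  else [::].

(** One entry per colouring that extends [s], with its total weight. Outcomes are compared as sets,
    by [=i]. *)
Fixpoint crun (s : seq strand) (w : seq slice) : seq (seq strand * W) :=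
  if w is x :: w' then
    [seq (u.1, t.2 + u.2) | t <- cstep s x, u <- crun t.1 w']
  else [:: (s, 0)].

Lemma cstepE A x B k e : size A = k -> size x = strands_in e ->
  cstep (A ++ x ++ B) (k, e) = [seq (A ++ t.1 ++ B, t.2) | t <- act e x].
Proof.
move=> <- sx; rewrite /cstep !size_cat sx leq_add2l leq_addr take_size_cat //.
rewrite -sx addnC -drop_drop !(drop_size_cat _ (erefl (size A))) take_size_cat //.
by rewrite drop_size_cat.
Qed.

Lemma actP e x t : t \in act e x -> orient_act e (unzip1 x) = Some (unzip1 t.1).
Proof.
case: e x => [o||[b|]] [|a [|a' []]] //=.
- by case/mapP=> c _ ->.
- by case: eqP => //= _; case: eqP => //= _; rewrite inE => /eqP ->.
- by case: rule => [[c d] z]; rewrite inE => /eqP ->.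
- by rewrite inE => /eqP ->.
Qed.

Lemma cstep_size s k e : cstep s (k, e) != [::] -> (k + strands_in e <= size s)%N.
Proof. by rewrite /cstep; case: ifP. Qed.

Local Arguments cstep : simpl never.

Lemma cstepP s x t : t \in cstep s x -> step (unzip1 s) x = Some (unzip1 t.1).
Proof.
case: x => k e ht; have : (k + strands_in e <= size s)%N.
  by apply: cstep_size; apply: contraTneq ht => ->.
case/split_window=> A [x [B [E sA sx]]]; move: ht; rewrite E cstepE //.
case/mapP=> u /actP hu ->; rewrite /unzip1 !map_cat stepE ?size_map //.
by rewrite -/unzip1 [orient_act _ _]hu /= -!map_cat.
Qed.

Lemma crunP s w t : t \in crun s w -> run (unzip1 s) w = Some (unzip1 t.1).
Proof.
elim: w s t => [|x w IH] s t /=; first by rewrite inE => /eqP ->.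
by case/allpairsPdep=> u [v [/cstepP hu /IH hv ->]]; rewrite run_cons hu.
Qed.

Lemma crun_cat s u v t : reflect
  (exists t1 t2, [/\ t1 \in crun s u, t2 \in crun t1.1 v & t = (t2.1, t1.2 + t2.2)])
  (t \in crun s (u ++ v)).
Proof.
apply: (iffP idP); elim: u s t => [|x u IH] s t /=.
- by move=> ht; exists (s, 0), t; rewrite inE eqxx add0r; case: t ht.
- case/allpairsPdep=> a [b [ha /IH [t1 [t2 [h1 h2 ->]]] ->]].
  exists (t1.1, a.2 + t1.2), t2; rewrite addrA; split=> //.
  by apply/allpairsPdep; exists a, t1.
- by case=> t1 [t2 [/[!inE]/eqP -> h2 ->]]; rewrite add0r; case: t2 h2.
- case=> t1 [t2 [/allpairsPdep[a [b [ha hb ->]]] /= h2 ->]].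
  apply/allpairsPdep; exists a, (t2.1, b.2 + t2.2); rewrite addrA; split=> //.
  by apply: IH; exists b, t2.
Qed.

Lemma cstep_frame A x B k e : (k + strands_in e <= size x)%N ->
  cstep (A ++ x ++ B) ((size A + k)%N, e) =
  [seq (A ++ t.1 ++ B, t.2) | t <- cstep x (k, e)].
Proof.
case/split_window=> P [y [Q [-> sP sy]]].
rewrite [in RHS]cstepE // (_ : A ++ _ = (A ++ P) ++ y ++ (Q ++ B)); last by rewrite !catA.
rewrite cstepE ?size_cat ?sP // -map_comp.
by apply: eq_map => t; rewrite /= !catA.
Qed.

Lemma crun_frame A x B w : height (size x) w ->
  crun (A ++ x ++ B) (shift (size A) w) = [seq (A ++ t.1 ++ B, t.2) | t <- crun x w].
Proof.
elim: w x => [|[k e] w IH] x //=; case: ifP => // h hw.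
rewrite cstep_frame // allpairs_mapl map_allpairs; congr flatten.
apply/eq_in_map => t ht; rewrite /= IH ?map_comp; first by rewrite -!map_comp.
move/cstepP/size_step: ht; rewrite !size_map => ->; exact: hw.
Qed.

Definition equivalent (o : seq bool) (u v : seq slice) : Prop :=
  forall s, unzip1 s = o -> crun s u =i crun s v.

Lemma equivalent_sym o u v : equivalent o u v -> equivalent o v u.
Proof. by move=> h s hs t; rewrite h. Qed.

Lemma equivalent_context o o1 u l r v : run o u = Some o1 -> equivalent o1 l r ->
  equivalent o (u ++ l ++ v) (u ++ r ++ v).
Proof.
suff H l' r' t s : run o u = Some o1 -> equivalent o1 l' r' -> unzip1 s = o ->
    t \in crun s (u ++ l' ++ v) -> t \in crun s (u ++ r' ++ v).
  move=> hu h s hs t; apply/idP/idP; apply: H => //; exact: equivalent_sym.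
move=> hu h hs /crun_cat[t1 [t2 [h1 /crun_cat[t3 [t4 [h3 h4 ->]]] ->]]].
apply/crun_cat; exists t1, (t4.1, t3.2 + t4.2); split=> //.
apply/crun_cat; exists t3, t4; split=> //; rewrite -h //.
by move: (crunP h1); rewrite hs hu => -[].
Qed.

(** [F] only sees coloured runs because the two smoothings of an antiparallel
    [classical_R2] need not be flat equivalent: they differ by moving a kink from
    one component to the other. *)
Definition interchangeable (o : seq bool) (l r : seq slice) : Prop :=
  [/\ run o l = run o r, equivalent o l r &
    forall (V : zmodType) (F : seq slice -> V),
      (forall u v, equivalent o u v -> F u = F v) ->
      \sum_(t <- smoothings o l) F t.2 *~ t.1 = \sum_(t <- smoothings o r) F t.2 *~ t.1].

Definition smoothing_sum (V : zmodType) (f : seq slice -> V) (w : seq slice) : V :=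
  \sum_(t <- smoothings [::] w) f t.2 *~ t.1.

(** The smoothed crossing lies below, inside or above the window of the move. In the first and last
    cases the terms agree one by one since [l] and [r] are equivalent; the middle case is the last
    clause of [interchangeable]. *)
Lemma smoothing_sum_local (V : zmodType) (f : seq slice -> V) o u l r v :
  (forall w w', equivalent [::] w w' -> f w = f w') ->
  run [::] u = Some o -> run o l -> interchangeable o l r ->
  smoothing_sum f (u ++ l ++ v) = smoothing_sum f (u ++ r ++ v).
Proof.
move=> hf hu hl [hlr elr h]; rewrite /smoothing_sum.
case ho1: (run o l) hl => [o1|] // _; move: hlr; rewrite ho1 => /esym hr.
rewrite !(smoothings_cat _ hu) (smoothings_cat _ ho1) (smoothings_cat _ hr).
rewrite !map_cat -!map_comp !big_cat !big_map /=; congr (_ + (_ + _)).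
- apply: eq_big_seq => t ht; congr (_ *~ _); apply: hf.
  exact: (equivalent_context _ (run_smoothings hu ht) elr).
- apply: (h _ (fun x => f (u ++ x ++ v))) => x y exy; apply: hf.
  exact: (equivalent_context _ hu exy).
- apply: eq_bigr => t _; congr (_ *~ _); apply: hf.
  exact: (equivalent_context _ hu elr).
Qed.

Lemma unzip1_cat (s : seq strand) a b : unzip1 s = a ++ b ->
  exists s1 s2, [/\ s = s1 ++ s2, unzip1 s1 = a & unzip1 s2 = b].
Proof.
move=> h; exists (take (size a) s), (drop (size a) s); rewrite cat_take_drop.
by move: h; rewrite /unzip1 map_take map_drop => ->; rewrite take_size_cat // drop_size_cat.
Qed.

(** The two words act on disjoint windows, so their outcomes combine independently and their weights
    add up in either order. The window of [v] starts after [x'] or after [x], according to whether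
    [u] comes first. *)
Lemma equivalent_far A x M y B u v x' y' : run x u = Some x' -> run y v = Some y' ->
  equivalent (A ++ x ++ M ++ y ++ B)
    (shift (size A) u ++ shift (size A + size x' + size M) v)
    (shift (size A + size x + size M) v ++ shift (size A) u).
Proof.
move=> hu hv s /unzip1_cat[A' [s1 [-> EA]]] /unzip1_cat[X [s2 [-> EX]]].
case/unzip1_cat=> P [s3 [-> EP]] /unzip1_cat[Y [B' [-> EY EB]]].
have sA : size A = size A' by rewrite -EA size_map.
have sx : size x = size X by rewrite -EX size_map.
have sM : size M = size P by rewrite -EP size_map.
(* The number of strands left by [u] depends on the orientations only, so it is the same for all
   colourings. *)
have sx' t : t \in crun X u -> size x' = size t.1.
  by move=> /crunP; rewrite EX hu => -[->]; rewrite size_map.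
have hu' : height (size X) u by rewrite -sx (run_height hu).
have hv' : height (size Y) v by rewrite -(size_map fst) [map _ _]EY (run_height hv).
have frame_v z : crun (A' ++ z ++ P ++ Y ++ B') (shift (size A' + size z + size P) v) =
    [seq (A' ++ z ++ P ++ q.1 ++ B', q.2) | q <- crun Y v].
  rewrite (_ : A' ++ z ++ _ = (A' ++ z ++ P) ++ Y ++ B'); last by rewrite -!catA.
  rewrite -addnA -!size_cat crun_frame //; apply: eq_map => q; by rewrite /= -!catA.
rewrite sA sx sM => t; apply/crun_cat/crun_cat=> -[t1 [t2 []]].
- rewrite crun_frame // => /mapP[p hp ->] /=; rewrite (sx' _ hp) (frame_v p.1).
  case/mapP=> q hq -> ->.
  exists (A' ++ X ++ P ++ q.1 ++ B', q.2), (A' ++ p.1 ++ P ++ q.1 ++ B', p.2).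
  rewrite /= addrC (frame_v X) crun_frame //.
  by split=> //; apply/mapP; [exists q|exists p].
- rewrite (frame_v X) => /mapP[q hq ->] /=; rewrite crun_frame // => /mapP[p hp ->] ->.
  exists (A' ++ p.1 ++ P ++ Y ++ B', p.2), (A' ++ p.1 ++ P ++ q.1 ++ B', q.2).
  rewrite /= addrC (sx' _ hp) (frame_v p.1) crun_frame //.
  by split=> //; apply/mapP; [exists p|exists q].
Qed.

(** Stated for words instead of single events, because smoothing turns a crossing into no event or
    two. A smoothed word has the same ends by [run_smoothings], so [equivalent_far] applies to it
    too. *)
Lemma interchangeable_far A x M y B u v x' y' : run x u = Some x' -> run y v = Some y' ->
  interchangeable (A ++ x ++ M ++ y ++ B)
    (shift (size A) u ++ shift (size A + size x' + size M) v)
    (shift (size A + size x + size M) v ++ shift (size A) u).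
Proof.
move=> hu hv.
have assoc z t : (A ++ z ++ M ++ t ++ B = (A ++ z ++ M) ++ t ++ B) by rewrite -!catA.
have ru t : run (A ++ x ++ M ++ t ++ B) (shift (size A) u) = Some (A ++ x' ++ M ++ t ++ B).
  by rewrite run_frame ?(run_height hu) // hu.
have rv z : run (A ++ z ++ M ++ y ++ B) (shift (size A + size z + size M) v) =
            Some (A ++ z ++ M ++ y' ++ B).
  by rewrite !assoc -addnA -!size_cat run_frame ?(run_height hv) // hv.
have sm z : smoothings (A ++ z ++ M ++ y ++ B) (shift (size A + size z + size M) v) =
    [seq (t.1, shift (size A + size z + size M) t.2) | t <- smoothings y v].
  by rewrite assoc -!addnA -!size_cat smoothings_frame ?hv.
split; first by rewrite !run_cat ru rv /= ru rv.
  exact: (equivalent_far hu hv).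
move=> V F hF; rewrite (smoothings_cat _ (ru _)) (smoothings_cat _ (rv _)).
rewrite smoothings_frame ?hu // smoothings_frame ?hu //.
rewrite (sm x) (sm x').
rewrite !big_cat !big_map /= [RHS]addrC; congr (_ + _); apply: eq_big_seq => t ht.
  by congr (_ *~ _); apply: hF; exact: (equivalent_far (run_smoothings hu ht) hv).
congr (_ *~ _); apply: hF.
exact: (equivalent_far hu (run_smoothings hv ht)).
Qed.

Lemma interchangeable_far_commute k l e f o : (k <= l)%N ->
  let u := [:: (k, e); (l + strands_out e, f)%N] in
  let v := [:: (l + strands_in e, f)%N; (k, e)] in
  run o u -> run o v -> interchangeable o u v.
Proof.
move=> kl u v; rewrite /u /v => ru rv.
have h1 : (k + strands_in e <= size o)%N.
  by apply: step_strands; move: ru; rewrite run_cons; case: step.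
have h2 : (l + strands_in e + strands_in f <= size o)%N.
  by apply: step_strands; move: rv; rewrite run_cons; case: step.
case/split_window: h1 => A [x [R [E sA sx]]].
have : (l - k + strands_in f <= size R)%N by rewrite E !size_cat in h2; lia.
case/split_window=> M [y [B [E' sM sy]]]; rewrite {R}E' in E.
have hx : exists x', orient_act e x = Some x'.
  move: ru; rewrite run_cons E stepE //.
  by case: orient_act => // z _; exists z.
have hy : exists y', orient_act f y = Some y'.
  move: rv; rewrite run_cons E (_ : A ++ _ = (A ++ x ++ M) ++ y ++ B); last by rewrite -!catA.
  rewrite stepE // ?size_cat; last by lia.
  by case: orient_act => // z _; exists z.
case: hx hy => x' hx [y' hy]; have sx' := orient_act_size hx.
have single z z' g : orient_act g z = Some z' -> size z = strands_in g ->
    run z [:: (0%N, g)] = Some z'.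
  by move=> hz sz; rewrite run_cons -[z]cats0 -[z ++ _]cat0s stepE // hz /= cats0.
have := @interchangeable_far A _ M _ B _ _ _ _ (single _ _ _ hx sx) (single _ _ _ hy sy).
rewrite -E /shift /= !addn0 sx' sx sA sM.
have swap n : (k + n + (l - k) = l + n)%N by lia.
by rewrite !swap.
Qed.

Hypothesis coloursP : forall c, c \in colours.

Fixpoint sequences (T : Type) (a : seq T) (m : nat) : seq (seq T) :=
  if m is m'.+1 then [seq x :: s | x <- a, s <- sequences a m'] else [:: [::]].

Lemma sequencesP (T : eqType) (a : seq T) m s :
  {subset s <= a} -> size s = m -> s \in sequences a m.
Proof.
elim: m s => [|m IH] [|x s] // h [hs]; apply/allpairsP; exists (x, s); split=> //=.
  by apply: h; rewrite mem_head.
by apply: IH => // y hy; apply: h; rewrite inE hy orbT.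
Qed.

(** Decision procedure for [equivalent] on a window: all colourings of the strands [o] are tried. *)
Definition same_runs (o : seq bool) (u v : seq slice) : bool :=
  [&& isSome (height (size o) u), isSome (height (size o) v) &
   all (fun c : seq C => let s := zip o c in
     all (mem (crun s v)) (crun s u) && all (mem (crun s u)) (crun s v))
    (sequences colours (size o))].

Lemma same_runsP A o B u v : same_runs o u v ->
  equivalent (A ++ o ++ B) (shift (size A) u) (shift (size A) v).
Proof.
case/and3P=> hu hv h s hs.
have : (size A + size o <= size s)%N by rewrite -(size_map fst) [map _ _]hs !size_cat; lia.
case/split_window=> A' [x [B' [E sA sx]]]; move: hs; rewrite E /unzip1 !map_cat.
move/eqP; rewrite eqseq_cat ?size_map ?sA // eqseq_cat ?size_map ?sx //.
case/and3P=> _ /eqP hx _; rewrite -sA !crun_frame ?sx //.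
apply: eq_mem_map; move/allP/(_ (unzip2 x)): h.
rewrite -hx -[map _ x]/(unzip1 x) zip_unzip size_map => /(_ _)/andP[].
  by apply: sequencesP; rewrite ?size_map // => c _; apply: coloursP.
by move=> /allP h1 /allP h2 t; apply/idP/idP => [/h1|/h2].
Qed.

(** Greedy matching: the first term is removed together with the first later one of opposite sign
    and same coloured runs. The number [n] is fuel. *)
Fixpoint cancelling (o : seq bool) (n : nat) (a : seq (int * seq slice)) : bool :=
  match n, a with
  | _, [::] => true
  | n'.+1, t :: a' =>
    let p t' := (t'.1 == - t.1) && same_runs o t.2 t'.2 in
    has p a' && cancelling o n' (rem (nth t a' (find p a')) a')
  | _, _ => false
  end.

Lemma cancellingP A o B n a (V : zmodType) (F : seq slice -> V) :
  (forall u v, equivalent (A ++ o ++ B) u v -> F u = F v) ->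
  cancelling o n a -> \sum_(t <- a) F (shift (size A) t.2) *~ t.1 = 0.
Proof.
move=> hF; elim: n a => [|n IH] [|t a] //=; rewrite ?big_nil // => /andP[h /IH {}IH].
have /andP[/eqP h1 h2] := nth_find t h; rewrite has_find in h.
rewrite big_cons (big_rem _ (mem_nth t h)) /= IH addr0 h1 mulrNz.
by rewrite (hF _ _ (@same_runsP A _ B _ _ h2)) subrr.
Qed.

(** The terms of [r] enter with negated signs, so that equality of the two sums becomes
    cancellation. *)
Definition checked_on (o : seq bool) (l r : seq slice) : bool :=
  [&& run o l == run o r, same_runs o l r &
   let a := smoothings o l ++ [seq (- t.1, t.2) | t <- smoothings o r] in
   cancelling o (size a) a].

(** That [l] fits on no level of fewer than [m] strands serves to locate the window: wherever a
    translate of [l] runs, [m] strands are available. Orientations on which one side does not run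
    are skipped, since both sides of an applied move run. *)
Definition checked (m : nat) (l r : seq slice) : bool :=
  [&& (0 < size l)%N, all (fun n => ~~ isSome (height n l)) (iota 0 m), isSome (height m l),
      isSome (height m r) &
      all (fun o => [|| ~~ isSome (run o l), ~~ isSome (run o r) | checked_on o l r])
          (sequences [:: true; false] m)].

Lemma checked_onP A o B l r : run o l -> run o r -> checked_on o l r ->
  interchangeable (A ++ o ++ B) (shift (size A) l) (shift (size A) r).
Proof.
move=> hl hr /and3P[/eqP h1 h2 h3]; split.
- have /and3P[hl' hr' _] := h2; by rewrite !run_frame // h1.
- exact: same_runsP.
move=> V F hF; rewrite !smoothings_frame // !big_map /=; apply/eqP.
rewrite -subr_eq0 -sumrN; apply/eqP; rewrite -[RHS](cancellingP hF h3) big_cat big_map /=.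
by congr (_ + _); apply: eq_bigr => t _; rewrite mulrNz.
Qed.

Lemma run_shift k o w o1 : (k <= size o)%N -> run o (shift k w) = Some o1 ->
  height (size o - k) w.
Proof.
elim: w o => [|[j e] w IH] o //= ko; rewrite run_cons; case h: step => [o2|] //=.
have /step_strands hs : step o ((k + j)%N, e) <> None by rewrite h.
have so := size_step h; move=> /IH; rewrite so ifT; last by lia.
by rewrite (_ : (_ - _ + _ - _ = size o - k - strands_in e + strands_out e)%N); [apply; lia|lia].
Qed.

Lemma checkedP m l r k o : checked m l r ->
  run o (shift k l) -> run o (shift k r) -> interchangeable o (shift k l) (shift k r).
Proof.
case/and5P=> l0 hm hl hr h rl rr.
have ko : (k <= size o)%N.
  case: l l0 rl {hm hl h} => // -[j e] l _; rewrite /= run_cons; case hs: step => [o2|] // _.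
  by have /step_strands : step o ((k + j)%N, e) <> None; [rewrite hs | lia].
(* To the right of the first [k] strands, [l] runs; it would fail there with fewer than [m]
   strands. *)
have mo : (k + m <= size o)%N.
  case rl': run rl => [o1|] // _; have := run_shift ko rl'.
  move/allP: hm => /(_ (size o - k)%N); rewrite mem_iota; case: ltnP => [|*]; last by lia.
  by move=> _ /(_ isT)/negP.
have [A [x [B [E sA sx]]]] := split_window mo; rewrite {}E -sA in rl rr *.
rewrite !run_frame ?sx // in rl rr.
have rl' : run x l by case: run rl.
have rr' : run x r by case: run rr.
apply: checked_onP => //; move/allP: h => /(_ x); rewrite rl' rr' /=; apply.
by apply: sequencesP => // -[].
Qed.

Hypothesis moves_checked : all (fun t => checked t.1.1 t.1.2 t.2) window_moves.

Lemma framed_interchangeable l r o : framed_move l r -> run o l -> run o r ->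
  interchangeable o l r.
Proof.
case/framed_move_window=> [[k [n [e [f [kn -> ->]]]]]|[k [m [l0 [r0 [h -> ->]]]]]].
  exact: interchangeable_far_commute.
exact: (checkedP (allP moves_checked _ h)).
Qed.

Lemma flat_equivalent l r o : flat_move l r -> run o l -> run o r -> equivalent o l r.
Proof.
case=> [{}l {}r /framed_interchangeable h hl hr|k b _ _ s _ t //].
by case: (h o hl hr).
Qed.

Definition weights (w : seq slice) : seq W := [seq t.2 | t <- crun [::] w].

Lemma local_run (M : seq slice -> seq slice -> Prop) (D D' : link_diagram) : local_move M D D' ->
  exists u v l r o, [/\ M l r, val D = u ++ l ++ v /\ val D' = u ++ r ++ v,
    run [::] u = Some o, run o l & run o r].
Proof.
case=> u [v [l [r [hM hD hD']]]]; exists u, v, l, r, (odflt [::] (run [::] u)).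
have := valP D; have := valP D'; rewrite /closed_diagram hD hD' !run_cat.
case: (run [::] u) => //= o; rewrite !run_cat.
by case: (run o r) => //= ?; case: (run o l).
Qed.

Lemma weights_flat D D' : move_equiv flat_move D D' -> weights (val D) =i weights (val D').
Proof.
elim=> {D D'} [D D' /local_run[u [v [l [r [o [hM [-> ->] hu hl hr]]]]]]|//
              |D D' _ IH w|D D1 D2 _ IH _ IH' w].
- by apply: eq_mem_map; apply: (equivalent_context _ hu (flat_equivalent hM hl hr)).
- by rewrite IH.
- by rewrite IH IH'.
Qed.

Lemma smoothing_sum_framed (V : zmodType) (f : seq slice -> V) D D' :
  (forall w w', weights w =i weights w' -> f w = f w') ->
  move_equiv framed_move D D' -> smoothing_sum f (val D) = smoothing_sum f (val D').
Proof.
move=> hf; elim=> {D D'} [D D' /local_run[u [v [l [r [o [hM [-> ->] hu hl hr]]]]]]|//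
              |D D' _ IH|D D1 D2 _ IH _ IH'].
- have hf' w w' : equivalent [::] w w' -> f w = f w'.
    by move=> e; apply: hf; apply: eq_mem_map; apply: e.
  exact: (smoothing_sum_local _ hf' hu hl (framed_interchangeable hM hl hr)).
- by rewrite IH.
- by rewrite IH IH'.
Qed.

(** By [weights_flat], [f] takes the same value on all diagrams of a flat class, so it descends to
    [g] through [repr]. The linear extension of [g] to the free group sends the smoothing invariant
    to the sum. *)
Lemma smoothing_sum_smoothing_invariant (V : lmodType int) (f : seq slice -> V) K K' :
  (forall w w', weights w =i weights w' -> f w = f w') ->
  smoothing_invariant K = smoothing_invariant K' ->
  smoothing_sum f (word K) = smoothing_sum f (word K').
Proof.
move=> hf; pose g (c : flat_class) := f (val (repr c)).
have hg D : g (flat_class_of D) = f (val D).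
  apply: hf; apply: weights_flat; apply/asboolP.
  by have /eqmodP := reprK (flat_class_of D).
suff H (J : knot_diagram) : fglift g (smoothing_invariant J) = smoothing_sum f (word J).
  by move=> h; rewrite -!H h.
rewrite /smoothing_sum -(sum_smoothings (fun z w => f w *~ z)); last exact: valP.
(* This is compatibility with subtraction, from which the laws for zero and addition follow. *)
have lB := lift_is_additive g.
have l0 : fglift g 0 = 0 by rewrite -(subrr 0) lB subrr.
have lD : {morph fglift g : x y / x + y}.
  by move=> x y; rewrite -{1}[y]opprK lB -[- y]sub0r lB l0 sub0r opprK.
rewrite (big_morph _ lD l0); apply: eq_bigr => d _.
by rewrite liftU hg /= -scaler_int intz.
Qed.

End ColouredRuns.

(** * The two colouring rules, and the exhaustive check of the moves *)

(** The colours follow the strands. The weight is the sign of the basis formed by the tangent of the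
    [true] strand and that of the [false] strand. *)
Definition index_rule (o o' c c' : bool) : bool * bool * int :=
  (c', c, if c == c' then 0 else if (o == o') == c then 1 else -1).

(** A colour is a pair [(c, p)], where [c] names a component and [p] changes at
    each crossing with the other one. *)
Definition parity_rule (o o' : bool) (c c' : bool * bool) : (bool * bool) * (bool * bool) * bool :=
  if c.1 == c'.1 then (c', c, c.2 != c'.2)
  else ((c'.1, ~~ c'.2), (c.1, ~~ c.2), false).

Definition bool_pairs := [seq (a, b) | a <- bools, b <- bools].

Lemma index_moves_checked :
  all (fun t => checked index_rule bools t.1.1 t.1.2 t.2) window_moves.
Proof. by vm_cast_no_check (erefl true). Qed.

Lemma parity_moves_checked :
  all (fun t => checked parity_rule bool_pairs t.1.1 t.1.2 t.2) window_moves.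
Proof. by vm_cast_no_check (erefl true). Qed.

(** * Index state sums as sums over colourings of the minima *)

Section Labels.

Lemma map_insert2 (T U : Type) (f : T -> U) k x y s :
  map f (insert2 k x y s) = insert2 k (f x) (f y) (map f s).
Proof. by rewrite /insert2 !map_cat /= map_take map_drop. Qed.

Lemma map_delete2 (T U : Type) (f : T -> U) k s :
  map f (delete2 k s) = delete2 k (map f s).
Proof. by rewrite /delete2 map_cat map_take map_drop. Qed.

Lemma map_nth0 (T U : Type) (f : T -> U) x0 k s : f (nth x0 s k) = nth (f x0) (map f s) k.
Proof.
have [ks|sk] := ltnP k (size s); first by rewrite (nth_map x0).
by rewrite !nth_default ?size_map.
Qed.

Lemma map_swap2 (T U : Type) (f : T -> U) x0 k s :
  map f (swap2 x0 k s) = swap2 (f x0) k (map f s).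
Proof. by rewrite /swap2 map_insert2 map_delete2 !map_nth0. Qed.

Lemma insert2_window (T : Type) (x y : T) A B : insert2 (size A) x y (A ++ B) = A ++ [:: x; y] ++ B.
Proof. by rewrite /insert2 take_size_cat // drop_size_cat. Qed.

Lemma delete2_window (T : Type) (x y : T) A B : delete2 (size A) (A ++ [:: x; y] ++ B) = A ++ B.
Proof.
rewrite /delete2 take_size_cat // -[(size A).+2]add2n -drop_drop drop_size_cat //=.
by rewrite drop0.
Qed.

Lemma nth_window (T : Type) (x0 x y : T) A B :
  (nth x0 (A ++ [:: x; y] ++ B) (size A) = x) * (nth x0 (A ++ [:: x; y] ++ B) (size A).+1 = y).
Proof. by rewrite /= !nth_cat ltnn subnn ltnNge leqnSn subSnn. Qed.

Lemma swap2_window (T : Type) (x0 x y : T) A B :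
  swap2 x0 (size A) (A ++ [:: x; y] ++ B) = A ++ [:: y; x] ++ B.
Proof.
by rewrite /swap2 delete2_window insert2_window !nth_window.
Qed.

Variable w : seq slice.
Hypothesis w_closed : closed_diagram w.

Lemma run_take j : run [::] (take j w) = Some (orientations w j).
Proof.
rewrite /orientations; move/eqP: w_closed; rewrite -{1}(cat_take_drop j w) run_cat.
by case: run.
Qed.

Lemma step_orientations j : (j < size w)%N ->
  step (orientations w j) (slice_at w j) = Some (orientations w j.+1).
Proof.
move=> jw; have := run_take j.+1; rewrite (take_nth (0%N, Cap)) // -cats1 run_cat run_take /=.
by rewrite run_cons; case: step.
Qed.

Lemma size_labels j : (j <= size w)%N -> size (labels w j) = size (orientations w j).
Proof.
elim: j => [|j IH] jw; first by rewrite /orientations take0.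
have := step_orientations jw; have := IH (ltnW jw); rewrite /=.
case: (slice_at w j) => k e sl st; rewrite (size_step st) -sl.
have : (k + strands_in e <= size (labels w j))%N by rewrite sl; apply: step_strands; rewrite st.
case/split_window=> A [x [B [-> <- sx]]]; case: e {st} sx => [o||c] /=.
- by move/size0nil=> ->; rewrite insert2_window !size_cat /=; lia.
- by case: x => [|a [|b []]] // _; rewrite delete2_window !size_cat /=; lia.
- by case: x => [|a [|b []]] // _; rewrite swap2_window !size_cat /=; lia.
Qed.

Lemma labels_event j a : (j <= size w)%N -> a \in labels w j -> (a < j)%N && is_min w a.
Proof.
elim: j a => // j IH a jw; have {}IH b := IH b (ltnW jw).
have {}IH b : b \in labels w j -> (b < j.+1)%N && is_min w b.
  by case/IH/andP=> /ltnW bj ->; rewrite ltnS bj.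
have st := step_orientations jw; have sl := size_labels (ltnW jw).
case E: (slice_at w j) st => [k e] /=; rewrite E => st.
have : (k + strands_in e <= size (labels w j))%N by rewrite sl; apply: step_strands; rewrite st.
case/split_window=> A [x [B [EL <- sx]]]; move: IH; rewrite EL.
case: e {st} sx E => [o||c] /= sx E IH.
- move: sx IH => /size0nil-> IH; rewrite insert2_window !mem_cat !inE orbb => /or3P[aA|/eqP->|aB].
  + by apply: IH; rewrite !mem_cat aA.
  + by rewrite ltnSn /is_min E.
  + by apply: IH; rewrite !mem_cat aB !orbT.
- case: x sx EL IH => [|b [|b' []]] // _ _ IH; rewrite delete2_window => aAB; apply: IH.
  by move: aAB; rewrite !mem_cat !inE => /orP[->|->]; rewrite ?orbT.
- case: x sx EL IH => [|b [|b' []]] // _ _ IH; rewrite swap2_window => aAB; apply: IH.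
  by move: aAB; rewrite !mem_cat !inE [(a == b) || _]orbC.
Qed.

Lemma crossing_label j : (j < size w)%N -> ~~ is_min w j ->
  [/\ is_min w (left_label w j), is_min w (right_label w j),
      (left_label w j < j)%N & (right_label w j < j)%N].
Proof.
move=> jw; have st := step_orientations jw; have sl := size_labels (ltnW jw).
have lab := @labels_event j _ (ltnW jw).
rewrite {1}/is_min /left_label /right_label; case: (slice_at w j) st => k e st /= ne.
have h : (k.+1 < size (labels w j))%N.
  rewrite sl -addn2; have : step (orientations w j) (k, e) <> None by rewrite st.
  by move/step_strands; case: e ne {st}.
by have /andP[-> ->] := lab _ (mem_nth 0%N (ltnW h)); have /andP[-> ->] := lab _ (mem_nth 0%N h).
Qed.

(** These are the colourings of the components, given by the colours of their minima. *)
Definition admissible (col : nat -> bool) : Prop := forall j, (j < size w)%N ->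
  (slice_at w j).2 = Cap -> col (left_label w j) = col (right_label w j).

Definition crossing_weight (col : nat -> bool) (j : nat) : int :=
  if is_classical w j then
    (index_rule (left_up w j) (right_up w j) (col (left_label w j)) (col (right_label w j))).2
  else 0.

Definition index_of (col : nat -> bool) : int := \sum_(j < size w) crossing_weight col j.

Definition coloured_strands (col : nat -> bool) (j : nat) : seq (bool * bool) :=
  zip (orientations w j) [seq col a | a <- labels w j].

(** A coloured run makes choices at minima only, and the labels remember from which minimum each
    strand has its colour. *)
Lemma cstep_coloured col j : (j < size w)%N ->
  cstep index_rule bools (coloured_strands col j) (slice_at w j) =
  match slice_at w j with
  | (k, Cup _) =>
    [seq (zip (orientations w j.+1) (insert2 k c c [seq col a | a <- labels w j]), 0) | c <- bools]
  | (_, Cap) => if col (left_label w j) == col (right_label w j)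
                then [:: (coloured_strands col j.+1, 0)] else [::]
  | (_, Cross _) => [:: (coloured_strands col j.+1, crossing_weight col j)]
  end.
Proof.
move=> jw; have st := step_orientations jw; have sl := size_labels (ltnW jw).
rewrite /coloured_strands /crossing_weight /left_label /right_label /left_up /right_up.
rewrite /is_classical /=; case: (slice_at w j) st => [k e] st.
have h1 : (k + strands_in e <= size (orientations w j))%N by apply: step_strands; rewrite st.
have h2 : (k + strands_in e <= size (labels w j))%N by rewrite sl.
case/split_window: h1 st sl => A [x [B [-> kA sx]]] st sl.
case/split_window: h2 sl => LA [lx [LB [-> kL slx]]] sl.
have sA : size A = size LA by rewrite kA kL.
have sx' : size x = size lx by rewrite sx slx.
have sz : size (zip A (map col LA)) = k by rewrite size_zip size_map -sA minnn.
have szx : size (zip x (map col lx)) = strands_in e.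
  by rewrite size_zip size_map -sx' minnn.
have zE X lX : size X = size lX -> zip (A ++ X ++ B) (map col LA ++ lX ++ map col LB) =
    zip A (map col LA) ++ zip X lX ++ zip B (map col LB).
  by move=> sX; rewrite !zip_cat ?size_map.
rewrite !map_cat zE ?size_map // cstepE //; move: st; rewrite stepE //.
case: e sx slx {szx sl sx'} => [o||c] /=.
- case: x => // _; case: lx => // _ [<-]; rewrite -kL -(size_map col) !insert2_window /=.
  by rewrite (zE [:: o; ~~ o] [:: true; true]) // (zE [:: o; ~~ o] [:: false; false]).
- case: x => [|b [|b' []]] // _; case: lx => [|l [|l' []]] // _ /=.
  rewrite -kL !nth_window delete2_window map_cat.
  by case: (b != b') => //= -[<-]; case: eqP => //= _; rewrite (zE [::] [::]).
- case: x => [|b [|b' []]] // _; case: lx => [|l [|l' []]] // _ /= [<-].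
  rewrite -kL !nth_window swap2_window kL -kA !nth_window !map_cat /=.
  by case: c => [b''|] /=; rewrite (zE [:: b'; b] [:: col l'; col l]).
Qed.

(** [crun] unfolds from the bottom, whereas an induction along [labels] adds one event on top. *)
Lemma crun_take j t : (j < size w)%N -> reflect
  (exists t1 t2, [/\ t1 \in crun index_rule bools [::] (take j w),
     t2 \in cstep index_rule bools t1.1 (slice_at w j) & t = (t2.1, t1.2 + t2.2)])
  (t \in crun index_rule bools [::] (take j.+1 w)).
Proof.
move=> jw; rewrite (take_nth (0%N, Cap)) // -cats1 -/(slice_at w j).
apply: (iffP (crun_cat _ _ _ _ _ _)) => -[t1 [t2 [h1 h2 ->]]]; exists t1; last first.
  exists t2; split=> //; apply/allpairsPdep; exists t2, (t2.1, 0); rewrite addr0; split=> //.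
    by rewrite inE.
  by case: (t2).
by case/allpairsPdep: h2 => a [b [ha /[!inE]/eqP -> ->]]; exists a; rewrite addr0.
Qed.

Lemma index_of_weight col : admissible col -> index_of col \in weights index_rule bools w.
Proof.
move=> adm; suff H j : (j <= size w)%N ->
    (coloured_strands col j, \sum_(i < j) crossing_weight col i)
      \in crun index_rule bools [::] (take j w).
  by apply/mapP; exists (coloured_strands col (size w), index_of col) => //;
    rewrite -{2}(take_size w); apply: H.
elim: j => [|j IH] jw; first by rewrite take0 inE big_ord0 /coloured_strands /orientations take0.
apply/crun_take => //; exists (coloured_strands col j, \sum_(i < j) crossing_weight col i).
exists (coloured_strands col j.+1, crossing_weight col j); rewrite big_ord_recr /=.
split=> //; first exact: (IH (ltnW jw)).
rewrite cstep_coloured //; have := adm j jw; rewrite /crossing_weight /is_classical.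
rewrite /coloured_strands /=; case: (slice_at w j) => k [o _||c _].
- by rewrite map_insert2 !inE; case: (col j); rewrite eqxx ?orbT.
- by move=> /(_ erefl) ->; rewrite eqxx inE.
- by rewrite inE.
Qed.

(** Not strict: at a minimum the position may lie outside the level, and the default label 0 equals
    [j] when [j] is 0. *)
Lemma left_label_le j : (j < size w)%N -> (left_label w j <= j)%N.
Proof.
move=> jw; rewrite /left_label; set k := (slice_at w j).1.
have [h|h] := ltnP k (size (labels w j)); last by rewrite nth_default.
by have /andP[/ltnW] := labels_event (ltnW jw) (mem_nth 0%N h).
Qed.

Lemma right_label_le j : (j < size w)%N -> (right_label w j <= j)%N.
Proof.
move=> jw; rewrite /right_label; set k := (slice_at w j).1.+1.
have [h|h] := ltnP k (size (labels w j)); last by rewrite nth_default.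
by have /andP[/ltnW] := labels_event (ltnW jw) (mem_nth 0%N h).
Qed.

(** Conversely to [index_of_weight], a coloured run is read from bottom to top, and its colouring of
    the minima is rebuilt one minimum at a time. *)
Lemma weight_index_of z : z \in weights index_rule bools w ->
  exists2 col, admissible col & z = index_of col.
Proof.
pose adm_below (j : nat) (col : nat -> bool) := forall i, (i < j)%N -> (slice_at w i).2 = Cap ->
  col (left_label w i) = col (right_label w i).
suff H j t : (j <= size w)%N -> t \in crun index_rule bools [::] (take j w) ->
    exists2 col, adm_below j col &
      t = (coloured_strands col j, \sum_(i < j) crossing_weight col i).
  case/mapP=> t ht ->; move: (H (size w) t (leqnn _)); rewrite take_size => /(_ ht).
  by case=> col adm ->; exists col.
elim: j t => [|j IH] t jw.
  rewrite take0 inE => /eqP ->; exists xpredT; first by [].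
  by rewrite big_ord0 /coloured_strands /orientations take0.
case/crun_take => // t1 [t2 [/(IH _ (ltnW jw))[col adm ->] h2 ->]]; rewrite /= in h2.
move: h2; rewrite cstep_coloured //; case E: (slice_at w j) => [k [o||c]].
(* The colour chosen at the minimum [j] is recorded at index [j]. All labels occurring earlier are
   smaller, so nothing already read changes. *)
- case/mapP=> c _ ->; pose col' a := if a == j then c else col a.
  have le_col a : (a < j)%N -> col' a = col a.
    by rewrite /col'; case: eqP => // ->; rewrite ltnn.
  have col_lab i : (i < j)%N -> col' (left_label w i) = col (left_label w i) /\
      col' (right_label w i) = col (right_label w i).
    move=> ij; have iw := ltn_trans ij jw.
    by rewrite !le_col // (leq_ltn_trans _ ij) ?left_label_le ?right_label_le.
  exists col'.
    move=> i; rewrite ltnS leq_eqVlt => /predU1P[->|ij]; first by rewrite E.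
    by have [-> ->] := col_lab i ij; apply: adm.
  congr (_, _).
    have col'j : col' j = c by rewrite /col' eqxx.
    rewrite /coloured_strands /= E map_insert2 col'j; congr (zip _ (insert2 _ _ _ _)).
    by apply/eq_in_map => a /(labels_event (ltnW jw))/andP[/le_col <-].
  rewrite big_ord_recr /= [crossing_weight col' j]/crossing_weight /is_classical E.
  rewrite !addr0.
  by apply: eq_bigr => i _; rewrite /crossing_weight; have [-> ->] := col_lab i (ltn_ord i).
- case: eqP => // ecol; rewrite inE => /eqP ->; exists col.
    by move=> i; rewrite ltnS leq_eqVlt => /predU1P[->|/adm].
  by rewrite big_ord_recr /= [crossing_weight col j]/crossing_weight /is_classical E.
- rewrite inE => /eqP ->; exists col; last by rewrite big_ord_recr.
  by move=> i; rewrite ltnS leq_eqVlt => /predU1P[->|/adm //]; rewrite E.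
Qed.

Lemma is_classical_min j : is_classical w j -> ~~ is_min w j.
Proof. by rewrite /is_classical /is_min; case: (slice_at w j) => k []. Qed.

Lemma index_of_ext col col' :
  (forall a, is_min w a -> (a < size w)%N -> col a = col' a) -> index_of col = index_of col'.
Proof.
move=> h; apply: eq_bigr => j _; rewrite /crossing_weight; case: ifP => // cj.
have [ml mr hl hr] := crossing_label (ltn_ord j) (is_classical_min cj).
by rewrite !h // (ltn_trans _ (ltn_ord j)).
Qed.

Lemma index_of_const c : index_of (fun=> c) = 0.
Proof. by apply: big1 => j _; rewrite /crossing_weight /= eqxx; case: ifP. Qed.

(** Exchanging the two colours reverses every basis. *)
Lemma index_of_neg col : index_of (fun a => ~~ col a) = - index_of col.
Proof.
rewrite /index_of -sumrN; apply: eq_bigr => j _; rewrite /crossing_weight /=.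
case: ifP => [_|]; last by rewrite oppr0.
by case: (col _); case: (col _); rewrite /= ?oppr0 //; case: (left_up w j == _); rewrite /= ?opprK.
Qed.

Let in_first : nat -> bool := same_component w 0.

Lemma intersection_index_of : intersection_index w = index_of in_first.
Proof.
rewrite /intersection_index big_mkcond; apply: eq_bigr => j _; rewrite /crossing_weight.
case: ifP => // _; rewrite /basis_sign /= -/in_first.
by case: (in_first _); case: (in_first _) => //=; case: (left_up w j == _); rewrite /= ?opprK.
Qed.

Lemma adjacent_sym : symmetric (@adjacent w).
Proof. by move=> a b; apply/eq_existsb => j; rewrite orbC. Qed.

Lemma connect_adjacent_sym : connect_sym (@adjacent w).
Proof. by apply: sym_connect_sym; apply: adjacent_sym. Qed.

Lemma same_component_ord (a b : 'I_(size w)) : same_component w a b = connect (@adjacent w) a b.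
Proof.
apply/existsP/idP => [[x /existsP[y /and3P[/eqP xa /eqP yb]]]|h].
  by rewrite (val_inj xa : x = a) (val_inj yb : y = b).
by exists a; apply/existsP; exists b; rewrite !eqxx h.
Qed.

Lemma first_admissible : admissible in_first.
Proof.
move=> j jw capj; have := crossing_label jw; rewrite /is_min capj => /(_ isT)[_ _ lj rj].
have w0 : (0 < size w)%N by apply: leq_ltn_trans jw.
rewrite /in_first -[0%N]/(val (Ordinal w0)).
rewrite -[left_label w j]/(val (Ordinal (ltn_trans lj jw))).
rewrite -[right_label w j]/(val (Ordinal (ltn_trans rj jw))) !same_component_ord.
apply: (same_connect_r connect_adjacent_sym); apply: connect1; apply/existsP.
by exists (Ordinal jw); rewrite /= capj !eqxx.
Qed.

Lemma admissible_component col (a b : 'I_(size w)) :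
  admissible col -> connect (@adjacent w) a b -> col a = col b.
Proof.
move=> adm /connectP[p]; elim: p a b => [|c p IH] a b /=; first by move=> _ ->.
case/andP=> /existsP[j /andP[/eqP capj lab]] /IH h /h <-.
have := adm j (ltn_ord j) capj.
by case/orP: lab => /andP[/eqP -> /eqP ->].
Qed.

End Labels.

(** * Connectedness of knot diagrams *)

Section Knots.

Variable w : seq slice.
Hypothesis w_closed : closed_diagram w.

(** The graph has all events as vertices, but its edges join labels at maxima, which are minima. *)
Lemma min_connect (a b : 'I_(size w)) : connect (@adjacent w) a b -> is_min w a -> is_min w b.
Proof.
case/connectP=> p; elim: p a => [|c p IH] a /=; first by move=> _ ->.
case/andP=> /existsP[j /andP[/eqP capj lab]] /IH h /h{}h _; apply: h.
have := crossing_label w_closed (ltn_ord j); rewrite {1}/is_min capj => /(_ isT)[ml mr _ _].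
by case/orP: lab => /andP[/eqP ea /eqP ec]; rewrite -?ea -?ec.
Qed.

Lemma first_min : (0 < size w)%N -> is_min w 0.
Proof.
move=> w0; have := step_orientations w_closed w0; rewrite /orientations take0 /is_min.
by case: (slice_at w 0) => k [].
Qed.

(** The number of components counts the roots that are minima, and by [min_connect] the root of a
    minimum is one of them. *)
Lemma knot_connected (a b : 'I_(size w)) : number_of_components w == 1%N ->
  is_min w a -> is_min w b -> connect (@adjacent w) a b.
Proof.
move=> /eqP w1 ma mb; have sym := @connect_adjacent_sym w.
apply/(fingraph.rootP sym); have /eq_leq/card_le1_eqP := w1; apply.
  by rewrite !inE /= roots_root //=; apply: min_connect (connect_root _ b) mb.
by rewrite !inE /= roots_root //=; apply: min_connect (connect_root _ a) ma.
Qed.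

Lemma one_component (a : 'I_(size w)) : is_min w a ->
  (forall b : 'I_(size w), is_min w b -> connect (@adjacent w) a b) ->
  number_of_components w == 1%N.
Proof.
move=> ma h; rewrite /number_of_components -(n_comp_connect (@connect_adjacent_sym w) a).
apply/eqP/eq_n_comp_r => b; rewrite !inE; apply/idP/idP => [/h//|/min_connect]; exact.
Qed.

Lemma knot_admissible_const col : number_of_components w == 1%N -> admissible w col ->
  forall a, is_min w a -> (a < size w)%N -> col a = col 0%N.
Proof.
move=> w1 adm a ma aw; have w0 : (0 < size w)%N by apply: leq_ltn_trans aw.
apply: (@admissible_component w col (Ordinal aw) (Ordinal w0)) => //.
exact: (@knot_connected (Ordinal aw) (Ordinal w0) w1 ma (first_min w0)).
Qed.

End Knots.

(** * Colourings of a smoothed knot *)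

Lemma slice_at_cat u v j :
  slice_at (u ++ v) j = if (j < size u)%N then slice_at u j else slice_at v (j - size u).
Proof. exact: nth_cat. Qed.

Lemma labels_cat u v j : (j <= size u)%N -> labels (u ++ v) j = labels u j.
Proof.
by elim: j => //= j IH ju; rewrite slice_at_cat ju IH // ltnW.
Qed.

Lemma labelsS w j : labels w j.+1 =
  let: (k, e) := slice_at w j in
  match e with
  | Cup _ => insert2 k j j (labels w j)
  | Cap => delete2 k (labels w j)
  | Cross _ => swap2 0%N k (labels w j)
  end.
Proof. by []. Qed.

Section SmoothedColourings.

Variables (u v site : seq slice) (x : slice) (col : nat -> bool).
Let d := size u.
Let w := u ++ x :: v.
Let w' := u ++ site ++ v.
(** The colouring of [w] induced by one of [w']. The event [d] is replaced by [size site] events, so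
    an index [i] above [d] becomes [i.-1 + size site]. *)
Let pulled i := if (i <= d)%N then col i else col (i.-1 + size site)%N.

Hypothesis x_not_max : x.2 <> Cap.
Hypothesis col_site :
  [seq col a | a <- labels w' (d + size site)] = [seq pulled a | a <- labels w d.+1].
Hypothesis col_new : forall a, (d <= a < d + size site)%N -> is_min w' a ->
  exists2 b, (b < d)%N && is_min w b & col a = col b.

Lemma slice_at_after i : slice_at w' (d + size site + i) = slice_at w (d.+1 + i).
Proof.
by rewrite /w /w' /d !slice_at_cat addSnnS -addnA !addKn !ltnNge !leq_addr.
Qed.

(** Above the site both words have the same events, so the agreement of colours in [col_site]
    propagates upward. *)
Lemma labels_after i :
  [seq col a | a <- labels w' (d + size site + i)] = [seq pulled a | a <- labels w (d.+1 + i)].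
Proof.
elim: i => [|i IH]; first by rewrite !addn0 col_site.
rewrite !addnS !labelsS slice_at_after.
(* The default label 0 of [swap2] is fixed by the reindexing. *)
have c0 : pulled 0 = col 0 by [].
have ci : pulled (d.+1 + i)%N = col (d + size site + i)%N.
  by rewrite /pulled leqNgt leq_addr /= addnAC.
case: (slice_at w (d.+1 + i)) => k [o||c].
- by rewrite !map_insert2 IH -ci.
- by rewrite !map_delete2 IH.
- by rewrite !map_swap2 IH c0.
Qed.

Lemma pulled_label j : (j < size w)%N -> closed_diagram w -> j != d ->
  exists2 j', (j' < size w')%N & [/\ slice_at w' j' = slice_at w j,
    pulled (left_label w j) = col (left_label w' j') &
    pulled (right_label w j) = col (right_label w' j')].
Proof.
move=> jw wc; rewrite neq_ltn => /orP[jd|].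
  exists j; first by rewrite size_cat -/d ltn_addr.
  have sl : slice_at w' j = slice_at w j by rewrite !slice_at_cat -/d jd.
  have lab : labels w' j = labels w j by rewrite !labels_cat // ltnW.
  have ld := leq_trans (left_label_le wc jw) (ltnW jd).
  have rd := leq_trans (right_label_le wc jw) (ltnW jd).
  split=> //; first by rewrite /pulled ld /left_label sl lab.
  by rewrite /pulled rd /right_label sl lab.
move=> dj; have /subnKC <- := dj; set i := (j - d.+1)%N.
have c0 : pulled 0 = col 0 by [].
exists (d + size site + i)%N.
  by move: jw; rewrite /w /w' !size_cat /= -/d /i; lia.
rewrite /left_label /right_label slice_at_after !(map_nth0 pulled) !(map_nth0 col) labels_after c0.
by split.
Qed.

Lemma pulled_admissible : closed_diagram w -> admissible w' col -> admissible w pulled.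
Proof.
move=> wc adm j jw capj; have [jd|jd] := eqVneq j d.
  by case: x_not_max; move: capj; rewrite jd slice_at_cat ltnn subnn.
have [j' j'w [sl -> ->]] := pulled_label jw wc jd.
by apply: adm; rewrite ?sl.
Qed.

(** Minima of [w'] outside the site come from minima of [w]; those inside have a colour from below
    by [col_new]. *)
Lemma pulled_const c : (forall a, is_min w a -> (a < size w)%N -> pulled a = c) ->
  forall a, is_min w' a -> (a < size w')%N -> col a = c.
Proof.
move=> h a ma aw'; have [ad|da] := ltnP a d.
  rewrite -(h a) /pulled ?(ltnW ad) //; last by rewrite size_cat -/d ltn_addr.
  by move: ma; rewrite /is_min !slice_at_cat -/d ad.
have [am|ma'] := ltnP a (d + size site).
  have [|b /andP[bd mb] ->] := col_new _ ma; first by rewrite da.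
  by rewrite -(h b) /pulled ?(ltnW bd) // size_cat -/d ltn_addr.
move: ma aw'; have /subnKC <- := ma'; set i := (a - (d + size site))%N.
rewrite /is_min slice_at_after => mi aw'; rewrite -(h (d.+1 + i)%N) //.
  by rewrite /pulled leqNgt leq_addr /= addnAC.
by move: aw'; rewrite /w /w' !size_cat /= -/d; lia.
Qed.

End SmoothedColourings.

(** A colouring that agrees on the two strands of the smoothing is induced by a
    colouring of the knot. *)
Lemma smoothing_separates w d : closed_diagram w -> number_of_components w == 1%N ->
  (d < size w)%N -> is_classical w d ->
  let w' := smooth_word w d in
  exists p q, forall col, admissible w' col -> col p = col q ->
    forall a, is_min w' a -> (a < size w')%N -> col a = col 0%N.
Proof.
move=> wc w1 dw cd w'; have wE : w = take d w ++ slice_at w d :: drop d.+1 w.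
  by rewrite -drop_nth ?cat_take_drop.
have su : size (take d w) = d by rewrite size_takel // ltnW.
have [ml mr ld rd] := crossing_label wc dw (is_classical_min cd).
have lab := @labels_event w wc d _ (ltnW dw).
have : ((slice_at w d).1.+1 < size (labels w d))%N.
  rewrite (size_labels wc (ltnW dw)) -addn2.
  have := step_orientations wc dw; move: cd; rewrite /is_classical.
  case: (slice_at w d) => k [o||c] // _ st.
  by apply: (@step_strands _ _ (Cross c)); rewrite st.
rewrite -addn2 => /split_window[A [lr [B [LE kA slr]]]].
case: lr slr LE => [|l [|r []]] // _ LE.
have ll : left_label w d = l by rewrite /left_label LE -kA nth_window.
have rl : right_label w d = r by rewrite /right_label LE -kA nth_window.
have w'E : exists2 site, w' = take d w ++ site ++ drop d.+1 w &
    site = [::] \/ exists o, site = [:: (size A, Cap); (size A, Cup o)].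
  rewrite /w' /smooth_word cd -kA; case: ifP => _; first by exists [::] => //; left.
  by eexists; [by []|right; eexists].
(* If the smoothing consists of two vertical strands, [l] and [r] are their labels. Otherwise [l] is
   a label at the new maximum and [d.+1] is the new minimum above it. *)
case: w'E => site w'E hsite; exists l, (if site is [::] then r else d.+1) => col adm lq.
pose pulled i := if (i <= size (take d w))%N then col i else col (i.-1 + size site)%N.
have pulled_lab : [seq pulled a | a <- labels w d] = [seq col a | a <- labels w d].
  by apply/eq_in_map => a /lab/andP[ad _]; rewrite /pulled su ltnW.
have lab' : labels w' d = labels w d by rewrite w'E [in RHS]wE !labels_cat ?su.
have labS : labels w d.+1 = A ++ [:: r; l] ++ B.
  rewrite labelsS LE; move: cd kA; rewrite /is_classical.
  by case: (slice_at w d) => k [o||c] //= _ <-; rewrite swap2_window.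
have x_cross : (slice_at w d).2 <> Cap.
  by move: cd; rewrite /is_classical; case: (slice_at w d) => k [].
have lw' m : (size A, Cap) = slice_at w' m -> labels w' m = labels w d ->
  left_label w' m = l /\ right_label w' m = r.
  by rewrite /left_label /right_label => <- -> /=; rewrite LE !nth_window.
have const : [seq col a | a <- labels w' (d + size site)] =
      [seq pulled a | a <- labels w d.+1] ->
    (forall a, (d <= a < d + size site)%N -> is_min w' a -> col a = col l) ->
    forall a, is_min w' a -> (a < size w')%N -> col a = col 0%N.
  move=> col_site col_new; rewrite w'E.
  have col_new' a : (size (take d w) <= a < size (take d w) + size site)%N ->
      is_min (take d w ++ site ++ drop d.+1 w) a ->
    exists2 b, (b < size (take d w))%N && is_min (take d w ++ slice_at w d :: drop d.+1 w) b
      & col a = col b.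
    rewrite su -w'E -wE => /col_new h /h ->; exists l => //.
    by rewrite -ll ld ml.
  have col_site' : [seq col a | a <- labels (take d w ++ site ++ drop d.+1 w)
      (size (take d w) + size site)] =
      [seq pulled a | a <- labels (take d w ++ slice_at w d :: drop d.+1 w) (size (take d w)).+1].
    by rewrite -wE -w'E su.
  apply: (pulled_const col_new').
  rewrite -wE => a; rewrite -[col 0]/(pulled 0).
  apply: (knot_admissible_const wc w1).
  have := pulled_admissible x_cross col_site'; rewrite -wE -w'E; exact.
have pulledS : [seq pulled a | a <- labels w d.+1] = [seq col a | a <- A ++ [:: r; l] ++ B].
  rewrite labS; apply/eq_in_map => a aS; have : a \in labels w d.
    by rewrite LE; move: aS; rewrite !mem_cat !inE [(a == l) || _]orbC.
  by move/lab/andP=> [ad _]; rewrite /pulled su ltnW.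
rewrite pulledS in const; case: hsite lq w'E const => [->|[o ->]] lq w'E const.
  apply: const => /=; last by move=> a; rewrite addn0 ltnNge andbC; case: (d <= a)%N.
  by rewrite addn0 lab' LE !map_cat /= lq.
have sl0 : slice_at w' d = (size A, Cap) by rewrite w'E slice_at_cat su ltnn subnn.
have sl1 : slice_at w' d.+1 = (size A, Cup o).
  by rewrite w'E slice_at_cat su ltnNge leqnSn subSnn.
have dw' : (d < size w')%N by rewrite w'E !size_cat su /=; lia.
have [lw rw] := lw' d (esym sl0) lab'.
(* The new maximum joins these two strands. *)
have lr : col l = col r.
  by have := adm d dw'; rewrite sl0 lw rw; apply.
apply: const => /= [|a]; rewrite addn2.
  rewrite !labelsS sl1 sl0 lab' LE delete2_window insert2_window !map_cat /=.
  by rewrite -lr lq.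
case/andP=> da; rewrite ltnS leq_eqVlt => /predU1P[->|ad]; first by rewrite lq.
have -> : a = d by apply/eqP; rewrite eqn_leq da andbT.
by rewrite /is_min sl0.
Qed.

(** * The polynomial invariant as a state sum *)

(** Written with [foldr], which, unlike a locked big operator, evaluates under [vm_compute]. *)
Definition max_index (w : seq slice) : nat :=
  foldr maxn 0%N [seq absz z | z <- weights index_rule bools w].

(** On the minima of the smoothing, an admissible colouring is constant, of index 0, or equals the
    colouring by the first component up to negation, which only changes the sign of the index. *)
Lemma abs_intersection_index w d : closed_diagram w -> number_of_components w == 1%N ->
  (d < size w)%N -> is_classical w d ->
  absz (intersection_index (smooth_word w d)) = max_index (smooth_word w d).
Proof.
move=> wc w1 dw cd; have [p [q sep]] := smoothing_separates wc w1 dw cd.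
move: (smooth_word w d) (smooth_closed d wc) sep => w' wc' sep.
rewrite /max_index foldrE big_map (intersection_index_of w').
have adm1 := first_admissible wc'; set col1 := same_component w' 0 in adm1 *.
have col1_weight := index_of_weight wc' adm1.
apply/eqP; rewrite eqn_leq; apply/andP; split.
  by rewrite (big_rem _ col1_weight) leq_maxl.
apply/bigmax_leqP_seq => z /(weight_index_of wc')[col adm ->] _.
have const c : (forall a, is_min w' a -> (a < size w')%N -> c a = c 0%N) -> index_of w' c = 0.
  by move=> h; rewrite (index_of_ext wc' h) index_of_const.
have [/(sep _ adm)/const -> //|colpq] := eqVneq (col p) (col q).
(* If the first component contains all minima, every admissible colouring is constant on them. *)
have [/(sep _ adm1) col1_const|col1pq] := eqVneq (col1 p) (col1 q).
  rewrite const // => a ma aw.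
  have w0 : (0 < size w')%N by apply: leq_ltn_trans aw.
  have := col1_const a ma aw; rewrite /col1 -[a]/(val (Ordinal aw)) -[0%N]/(val (Ordinal w0)).
  rewrite !same_component_ord connect0 => h.
  by rewrite (admissible_component adm h).
pose dif a := col a (+) col1 a.
(* Neither colouring agrees on the two strands of the smoothing, so their sum does. *)
have adm' : admissible w' dif.
  by move=> j jw capj; rewrite /dif adm // adm1.
have /(sep _ adm') dif_const : dif p = dif q.
  by rewrite /dif; move: colpq col1pq; case: (col p); case: (col q); case: (col1 p); case: (col1 q).
case: (dif 0%N) dif_const => dif_const.
  have -> : index_of w' col = - index_of w' col1; last by rewrite abszN.
  rewrite -index_of_neg; apply: (index_of_ext wc') => a ma aw.
  by have := dif_const a ma aw; rewrite /dif; case: (col a); case: (col1 a).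
rewrite (index_of_ext wc' (col' := col1)) // => a ma aw.
by have := dif_const a ma aw; rewrite /dif; case: (col a); case: (col1 a).
Qed.

Definition smoothing_poly (f : seq slice -> nat) : seq slice -> {poly int} :=
  smoothing_sum (fun w => 'X^(f w)).

Lemma polynomial_invariantE D : polynomial_invariant D = smoothing_poly max_index (word D).
Proof.
rewrite /smoothing_poly /smoothing_sum.
rewrite -(sum_smoothings (fun z w => 'X^(max_index w) *~ z)); last exact: valP.
apply: eq_bigr => d cd; rewrite abs_intersection_index //; last exact: (valP D).
  by rewrite -scaler_int intz.
exact: (valP (val D)).
Qed.

Lemma max_index_weights w w' :
  weights index_rule bools w =i weights index_rule bools w' -> max_index w = max_index w'.
Proof.
by move=> h; rewrite /max_index !foldrE !(big_map absz) (eq_big_idem _ _ maxnn h).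
Qed.

(** Weights in [bool] add modulo 2. On two components with even [i], different names give the parity
    in question and equal names give [false]. With odd [i], different names cannot close up, and
    equal names with different second entries give [true]. *)
Definition odd_parity (w : seq slice) : nat := true \in weights parity_rule bool_pairs w.

Lemma odd_parity_weights w w' :
  weights parity_rule bool_pairs w =i weights parity_rule bool_pairs w' ->
  odd_parity w = odd_parity w'.
Proof. by move=> h; rewrite /odd_parity h. Qed.

Lemma boolsP b : b \in bools. Proof. by case: b. Qed.
Lemma bool_pairsP c : c \in bool_pairs. Proof. by case: c => [[] []]. Qed.

Lemma polynomial_of_smoothing K K' : smoothing_invariant K = smoothing_invariant K' ->
  polynomial_invariant K = polynomial_invariant K'.
Proof.
move=> h; rewrite !polynomial_invariantE.
apply: (smoothing_sum_smoothing_invariant boolsP index_moves_checked _ h) => w w' e.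
by rewrite (max_index_weights e).
Qed.

(** * Two knots separated by the smoothing invariant only *)

(** The closure of the virtual braid s1 s1 v1 s2 s1^-1 v2. *)
Definition braid_word : seq slice :=
  [:: (0%N, Cup true); (1%N, Cup true); (2%N, Cup true);
      (0%N, Cross (Classical true)); (0%N, Cross (Classical true)); (0%N, Cross Virtual);
      (1%N, Cross (Classical true)); (0%N, Cross (Classical false)); (1%N, Cross Virtual);
      (2%N, Cap); (1%N, Cap); (0%N, Cap)].

(** The two positive kinks match the sum 2 of the crossing signs of the braid. Smoothing a kink
    splits off a circle that crosses nothing of the rest. *)
Definition kinks_word : seq slice :=
  [:: (0%N, Cup true)] ++ kink OnRight 0 true (Classical true) ++
  kink OnRight 0 true (Classical true) ++ [:: (0%N, Cap)].

Lemma braid_closed : closed_diagram braid_word. Proof. by vm_compute. Qed.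
Lemma kinks_closed : closed_diagram kinks_word. Proof. by vm_compute. Qed.

Lemma adjacent_min w (a b : 'I_(size w)) j : (j < size w)%N ->
  (slice_at w j).2 = Cap -> left_label w j = a -> right_label w j = b ->
  connect (@adjacent w) a b /\ connect (@adjacent w) b a.
Proof.
move=> jw cap la rb; rewrite [connect _ b a]connect_adjacent_sym.
by split; apply/connect1/existsP; exists (Ordinal jw); rewrite /= cap la rb !eqxx.
Qed.

Lemma braid_knot : number_of_components braid_word == 1%N.
Proof.
pose o j (h : (j < size braid_word)%N) := Ordinal h.
apply: (@one_component _ braid_closed (o 0%N isT)) => // -[b hb] /= mb.
(* The maxima of index 10 and 11 join the minimum 0 to the minima 1 and 2. *)
have [c01 _] := @adjacent_min braid_word (o 0%N isT) (o 1%N isT) 10 isT erefl erefl erefl.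
have [_ c02] := @adjacent_min braid_word (o 2%N isT) (o 0%N isT) 11 isT erefl erefl erefl.
have [E|] := eqVneq b 0%N; first by rewrite (_ : Ordinal hb = o 0%N isT) //; apply: val_inj.
have [E _|] := eqVneq b 1%N; first by rewrite (_ : Ordinal hb = o 1%N isT) //; apply: val_inj.
have [E _ _|] := eqVneq b 2%N; first by rewrite (_ : Ordinal hb = o 2%N isT) //; apply: val_inj.
by move: b hb mb; do 12!case=> //.
Qed.

Lemma kinks_knot : number_of_components kinks_word == 1%N.
Proof.
pose o j (h : (j < size kinks_word)%N) := Ordinal h.
apply: (@one_component _ kinks_closed (o 0%N isT)) => // -[b hb] /= mb.
(* The maxima of index 3 and 7 join the minimum 0 to the minima 1 and 4. *)
have [c01 _] := @adjacent_min kinks_word (o 0%N isT) (o 1%N isT) 3 isT erefl erefl erefl.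
have [_ c04] := @adjacent_min kinks_word (o 4%N isT) (o 0%N isT) 7 isT erefl erefl erefl.
have [E|] := eqVneq b 0%N; first by rewrite (_ : Ordinal hb = o 0%N isT) //; apply: val_inj.
have [E _|] := eqVneq b 1%N; first by rewrite (_ : Ordinal hb = o 1%N isT) //; apply: val_inj.
have [E _ _|] := eqVneq b 4%N; first by rewrite (_ : Ordinal hb = o 4%N isT) //; apply: val_inj.
by move: b hb mb; do 8!case=> //.
Qed.

Definition braid_diagram : knot_diagram :=
  exist _ (exist _ braid_word braid_closed) braid_knot.
Definition kinks_diagram : knot_diagram :=
  exist _ (exist _ kinks_word kinks_closed) kinks_knot.

(** This isolates the list of signs and exponents, which can be computed, from the polynomial
    arithmetic. *)
Lemma smoothing_poly_seq f w : smoothing_poly f w =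
  \sum_(t <- [seq (t.1, f t.2) | t <- smoothings [::] w]) 'X^(t.2) *~ t.1.
Proof. by rewrite big_map. Qed.

(** The crossings [s2] and [s1^-1] have opposite signs and both give exponent 1, so they cancel;
    each [s1] contributes 1. *)
Lemma braid_max_index : smoothing_poly max_index braid_word = 2%:R.
Proof.
rewrite smoothing_poly_seq (_ : map _ _ = [:: (1, 0%N); (1, 0%N); (1, 1%N); (-1, 1%N)]); last first.
  by vm_compute.
by rewrite !big_cons big_nil /= mulrNz !mulr1z addr0 subrr addr0 expr0.
Qed.

Lemma kinks_max_index : smoothing_poly max_index kinks_word = 2%:R.
Proof.
rewrite smoothing_poly_seq (_ : map _ _ = [:: (1, 0%N); (1, 0%N)]); last by vm_compute.
by rewrite !big_cons big_nil /= !mulr1z addr0 expr0.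
Qed.

(** The last two terms cancel again, but smoothing either [s1] now gives an odd number. *)
Lemma braid_odd_parity : smoothing_poly odd_parity braid_word = 'X *+ 2.
Proof.
rewrite smoothing_poly_seq (_ : map _ _ = [:: (1, 1%N); (1, 1%N); (1, 1%N); (-1, 1%N)]); last first.
  by vm_compute.
by rewrite !big_cons big_nil /= mulrNz !mulr1z addr0 subrr addr0 expr1.
Qed.

Lemma kinks_odd_parity : smoothing_poly odd_parity kinks_word = 2%:R.
Proof.
rewrite smoothing_poly_seq (_ : map _ _ = [:: (1, 0%N); (1, 0%N)]); last by vm_compute.
by rewrite !big_cons big_nil /= !mulr1z addr0 expr0.
Qed.

(** * Passage to arbitrary representatives, and conclusion *)

Lemma represents_equiv D0 D : represents D (\pi_{eq_quot framed_rel} D0) ->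
  move_equiv framed_move (val D) (val D0).
Proof. by rewrite /represents => /eqmodP/asboolP. Qed.

Lemma max_index_framed D D' : move_equiv framed_move D D' ->
  smoothing_poly max_index (val D) = smoothing_poly max_index (val D').
Proof.
apply: (smoothing_sum_framed boolsP index_moves_checked) => w w' e.
by rewrite (max_index_weights e).
Qed.

Lemma odd_parity_framed D D' : move_equiv framed_move D D' ->
  smoothing_poly odd_parity (val D) = smoothing_poly odd_parity (val D').
Proof.
apply: (smoothing_sum_framed bool_pairsP parity_moves_checked) => w w' e.
by rewrite (odd_parity_weights e).
Qed.

Theorem proposition12 :
  (forall (K K' : framed_virtual_knot) (D D' : knot_diagram),
     represents D K -> represents D' K' ->
     smoothing_invariant D = smoothing_invariant D' ->
     polynomial_invariant D = polynomial_invariant D')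
  /\
  (exists K1 K2 : framed_virtual_knot,
     forall D1 D2 : knot_diagram, represents D1 K1 -> represents D2 K2 ->
       polynomial_invariant D1 = polynomial_invariant D2 /\
       smoothing_invariant D1 <> smoothing_invariant D2).
Proof.
split=> [K K' D D' _ _|]; first exact: polynomial_of_smoothing.
exists (\pi_{eq_quot framed_rel} braid_diagram), (\pi_{eq_quot framed_rel} kinks_diagram).
move=> D1 D2 /represents_equiv e1 /represents_equiv e2; split.
  (* Framed invariance carries arbitrary representatives to the two explicit diagrams. *)
  rewrite !polynomial_invariantE /word (max_index_framed e1) (max_index_framed e2).
  by rewrite /= braid_max_index kinks_max_index.
have hf w w' : weights parity_rule bool_pairs w =i weights parity_rule bool_pairs w' ->
    'X^(odd_parity w) = 'X^(odd_parity w') :> {poly int}.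
  by move=> e; rewrite (odd_parity_weights e).
move/(smoothing_sum_smoothing_invariant bool_pairsP parity_moves_checked hf).
rewrite -!/(smoothing_poly odd_parity _) /word (odd_parity_framed e1) (odd_parity_framed e2).
(* The coefficients of ['X] in the two sums are 2 and 0. *)
rewrite /= braid_odd_parity kinks_odd_parity => /(congr1 (fun p : {poly int} => p`_1)).
by rewrite coefMn coefX coefMn coef1.
Qed.
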